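(* Let $\Bbbk$ be a field, let $a,b\ge 1$ be real numbers, and denote $M=\max\{a,b\}$, $m=\min\{a,b\}$. With $\mathrm{Res}(a,b)$ the set of possible values of $\rho(I+J)$ as defined in the context, the following statements hold. (1) $\mathrm{Res}(a,b)\subseteq\left[M,\max\left\{M,\frac{2(a+b)}{3}\right\}\right]$. (2) If $M\ge 2m$ and $\mathrm{Res}(a,b)\neq\emptyset$, then $\mathrm{Res}(a,b)=\{M\}$. (3) $\mathrm{Res}(1,1)=\{1\}\cup\left\{\frac{n+1}{n}: n\ge 3\right\}$, where $n$ ranges over integers.
   Context: For an ideal $I$ of a noetherian ring $A$ and $n\ge 1$, the $n$-th symbolic power (defined via associated primes) is $I^{(n)}=\bigcap_{\mathfrak p\in \operatorname{Ass}(I)}(I^nA_{\mathfrak p}\cap A)$, where $\operatorname{Ass}(I)$ is the set of associated primes of $A/I$ and $I^nA_{\mathfrak p}\cap A$ is the preimage of $I^nA_{\mathfrak p}$ in $A$. The resurgence of a nonzero proper homogeneous ideal $I$ in a standard graded polynomial ring over $\Bbbk$ (finitely many variables of degree 1) is $\rho(I)=\sup\{\frac{m}{r}: I^{(m)}\not\subseteq I^r,\ m\ge 1,\ r\ge 1\}$ ($m,r$ integers). For real numbers $a,b\ge 1$, $\mathrm{Res}(a,b)$ is the set of all values $\rho(I+J)$, where $I\subseteq A$ and $J\subseteq B$ are nonzero proper homogeneous ideals in standard graded polynomial rings $A,B$ over $\Bbbk$ in disjoint sets of variables such that $\rho(I)=a$ and $\rho(J)=b$, and $I+J$ is the ideal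 generated by $I$ and $J$ in $A\otimes_\Bbbk B$. *)

(* Defs.v *)
From HB Require Import structures.
From mathcomp Require Import all_boot all_order all_algebra.
From mathcomp Require Import fraction.
(* mpoly has to be imported before the analysis files: the opposite order
   makes their notations clash. *)
From mathcomp Require Import mpoly.
From mathcomp Require Import classical_sets reals constructive_ereal ereal.

Set Implicit Arguments.
Unset Strict Implicit.
Unset Printing Implicit Defensive.

Import Order.TTheory GRing.Theory Num.Theory.

Local Open Scope classical_set_scope.
Local Open Scope ring_scope.

(* Ideals are Prop-valued sets; ring_quotient's ideals are decidable. *)
Section CommutativeAlgebra.

Variable A : comNzRingType.

(* The finite sums of c * x with c in D and x in X: when D is a subring of A,
   this is the D-submodule of A generated by X. *)
Definition span (D X : set A) : set A :=
  [set z | exists (r : nat) (c x : 'I_r -> A),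
     [/\ forall i, D (c i), forall i, X (x i) & z = \sum_(i < r) c i * x i]].

Definition ideal_gen (X : set A) : set A := span setT X.

Definition is_ideal (I : set A) : Prop :=
  [/\ I 0, forall x y, I x -> I y -> I (x + y) & forall a x, I x -> I (a * x)].

Definition is_prime_ideal (P : set A) : Prop :=
  [/\ is_ideal P, ~ P 1 & forall x y, P (x * y) -> P x \/ P y].

Definition ideal_power (I : set A) (n : nat) : set A :=
  ideal_gen [set z | exists2 x : 'I_n -> A,
                       forall i, I (x i) & z = \prod_(i < n) x i].

(* The associated primes of the module A / I: the prime ideals that are the
   annihilator { a | a * x \in I } of the class of some x. *)
Definition Ass (I : set A) : set (set A) :=
  [set P | is_prime_ideal P /\ exists x, P = [set a | I (a * x)]].

End CommutativeAlgebra.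

Section SymbolicPower.

Variable A : idomainType.

(* The localization A_P of the domain A at a prime ideal P, as a subring of
   the field of fractions of A. *)
Definition localization (P : set A) : set {fraction A} :=
  [set z | exists a s, ~ P s /\ z = tofrac a / tofrac s].

(* The ideal I A_P of A_P. *)
Definition extension (P I : set A) : set {fraction A} :=
  span (localization P) (@tofrac A @` I).

Definition symbolic_power (I : set A) (n : nat) : set A :=
  \bigcap_(P in Ass I) (@tofrac A @^-1` extension P (ideal_power I n)).

(* In \bar R, since the supremum is not known a priori to be finite. *)
Definition resurgence (R : realType) (I : set A) : \bar R :=
  ereal_sup [set q : \bar R | exists m r : nat,
    [/\ (1 <= m)%N, (1 <= r)%N,
        ~ (symbolic_power I m `<=` ideal_power I r)
      & q = (m%:R / r%:R)%:E]].

End SymbolicPower.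

Section Res.

Variable k : fieldType.

Definition is_homogeneous_ideal (n : nat) (I : set {mpoly k[n]}) : Prop :=
  exists2 S : set {mpoly k[n]},
    (forall f, S f -> exists d : nat, f \is d.-homog) & I = ideal_gen S.

Definition nonzero_proper_homogeneous (n : nat) (I : set {mpoly k[n]}) : Prop :=
  [/\ is_homogeneous_ideal I, I <> [set 0] & I <> setT].

(* The tensor product of k[x_1..x_n] and k[y_1..y_p] is identified with the
   polynomial ring in n + p variables; the two factors embed by sending their
   variables to the first n, respectively the last p, variables. *)
Definition embed_left (n p : nat) (f : {mpoly k[n]}) : {mpoly k[n + p]} :=
  comp_mpoly [tuple 'X_(lshift p i) | i < n] f.

Definition embed_right (n p : nat) (g : {mpoly k[p]}) : {mpoly k[n + p]} :=
  comp_mpoly [tuple 'X_(rshift n i) | i < p] g.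

Definition ideal_sum (n p : nat) (I : set {mpoly k[n]}) (J : set {mpoly k[p]}) :
    set {mpoly k[n + p]} :=
  ideal_gen (@embed_left n p @` I `|` @embed_right n p @` J).

Definition Res (R : realType) (a b : R) : set (\bar R) :=
  [set q | exists (n p : nat) (I : set {mpoly k[n]}) (J : set {mpoly k[p]}),
     [/\ nonzero_proper_homogeneous I, nonzero_proper_homogeneous J,
         resurgence R I = a%:E, resurgence R J = b%:E
       & q = resurgence R (ideal_sum I J)]].

End Res.

(* Main.v *)
Require Import Defs.
From HB Require Import structures.
From mathcomp Require Import all_boot all_order all_algebra.
From mathcomp Require Import fraction.
From mathcomp Require Import mpoly.
From mathcomp Require Import boolp classical_sets reals constructive_ereal ereal.
From mathcomp Require Import zify ring lra.

(** Everything rests on the binomial formula for symbolic powers,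
      (I + J)^(N) = sum over i + j = N of I^(i) J^(j),
    where I^(i) is the symbolic power, and I^{i} below is the ordinary one. It is
    valid over any field, for the definition through all associated primes.

    The inclusion of the right-hand side holds because an associated prime of
    I + J contracts to an associated prime of I and to one of J
    ([ass_contractL]): an element of the first ring kills h modulo I + J exactly
    when it kills modulo I the finitely many coordinates of h along a k-basis
    of the second ring modulo J, and a prime that is a finite intersection of
    annihilators is one of them. For the other inclusion, linear algebra of two
    filtrations shows that the right-hand side is the intersection of the ideals
    I^(i) + J^(j) with i + j = N + 1 ([filtration_product_of_tensor_sum]). So an
    element h outside of it lies outside of one such I^(i) + J^(j), hence
    outside of some E + F, where E is a P-primary ideal containing I^{i} and F
    a Q-primary ideal containing J^{j}, for associated primes P of I and Q of J: an
    ideal that is closed under division by elements outside P is an intersection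
    of P-primary ideals ([coprimary_avoiding], a form of Krull's intersection
    theorem). A filtration of the ring modulo E whose layers are torsion-free of
    rank one over the ring modulo P then shows that (E + F : h) lies in
    (P + Q : r) for some r outside P + Q ([coprimary_colon_reduction]). As
    P + Q is itself the annihilator of a class modulo I + J, some associated
    prime of I + J contains (E + F : h), which contains ((I + J)^{N} : h), and
    h is not in (I + J)^(N).

    Orders of vanishing add: if f is outside I^{s+1} and g outside J^{t+1}, then
    f g is outside (I + J)^{s+t+1}. Hence every failure
    (I+J)^(N) not in (I+J)^{r} comes from f in I^(i), g in J^(j) with i + j = N,
    of exact orders s and t with s + t + 1 <= r, while i <= a (s + 1) and
    j <= b (t + 1). If i or j is 0 this gives N / r <= max(a, b). Otherwise
    s, t >= 1, since I^(1) = I, and (a (s+1) + b (t+1)) / (s+t+1) is at most the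
    larger of max(a, b) and its value 2 (a + b) / 3 at s = t = 1. This is the
    first claim, and the second is immediate from it. For a = b = 1 one has
    I^(i) in I^{i-1}, so only the first exponents i0, j0 at which symbolic and
    ordinary powers of I and J differ matter: the resurgence of the sum is
    (i0 + j0) / (i0 + j0 - 1) if both exist and 1 otherwise, and i0, j0 >= 2.

    It remains to find, for each q >= 2, an ideal of resurgence 1 whose symbolic
    and ordinary powers first differ at q. Give x, y, t the weights 1, 2, 0, and
    let D be large. The ideal generated by
      v = x^(2D), u = x^(2D-2) y, z = y^D,
      w = x^(2D-2q) y^q + t^kappa x^2 y^(D-1)
    and all monomials of weight above 2D has the following powers: the n-th one
    consists of the polynomials without monomials of weight below 2Dn whose part
    of weight 2Dn is a form of degree n in u, v, z, w over k[t]. So I^(n), having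
    no monomials of weight below 2Dn either, lies in I^{n-1}, and the resurgence
    is 1. At t = 0 the four generators become monomials, and no relation between
    them has lower degree than u^q = v^(q-1) w. Below degree q the products of
    generators therefore have distinct leading monomials with coefficient 1, so
    no division by an element of k[t] gives anything new and I^{n} = I^(n); in
    degree q, the quotient of v^(q-1) w - u^q by t^kappa is a new element of
    I^(q). The element w enters that relation linearly, which makes the
    construction independent of the characteristic. Sums of such ideals for 2 and
    for n - 1 give (n + 1) / n, and the value 1 is attained by (x^2, y), whose
    symbolic and ordinary powers agree. *)

Set Implicit Arguments.
Unset Strict Implicit.
Unset Printing Implicit Defensive.

Import Order.TTheory GRing.Theory Num.Theory.

Local Open Scope classical_set_scope.
Local Open Scope ring_scope.

(** * Ideals, their powers, prime ideals *)

Section Ideals.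

Variable A : comNzRingType.
Implicit Types (I J K P X Y : set A) (a b f g h s t x y z : A).

Lemma ideal0 I : is_ideal I -> I 0. Proof. by case. Qed.

Lemma idealD I x y : is_ideal I -> I x -> I y -> I (x + y).
Proof. by case=> _ addI _; apply: addI. Qed.

Lemma idealMl I a x : is_ideal I -> I x -> I (a * x).
Proof. by case=> _ _ mulI; apply: mulI. Qed.

Lemma idealMr I a x : is_ideal I -> I x -> I (x * a).
Proof. by rewrite mulrC; apply: idealMl. Qed.

Lemma idealN I x : is_ideal I -> I x -> I (- x).
Proof. by move=> idI Ix; rewrite -mulN1r; apply: idealMl. Qed.

Lemma idealB I x y : is_ideal I -> I x -> I y -> I (x - y).
Proof. by move=> idI Ix Iy; apply: idealD => //; apply: idealN. Qed.

Lemma idealBr I x y : is_ideal I -> I (x - y) -> I y -> I x.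
Proof. by move=> idI Ixy Iy; rewrite -(subrK y x); apply: idealD. Qed.

Lemma ideal_sum_in (S : Type) (r : seq S) (p : pred S) (F : S -> A) I :
  is_ideal I -> (forall i, p i -> I (F i)) -> I (\sum_(i <- r | p i) F i).
Proof.
move=> idI FI; elim/big_ind: _ => //; first exact: ideal0.
by move=> x y; apply: idealD.
Qed.

Lemma ideal_all I : is_ideal I -> I 1 -> forall x, I x.
Proof. by move=> idI I1 x; rewrite -(mulr1 x); apply: idealMl. Qed.

Lemma is_ideal_gen X : is_ideal (ideal_gen X).
Proof.
split.
- by exists 0%N, (fun=> 0), (fun=> 0); split=> [||]; [case|case|rewrite big_ord0].
- move=> _ _ [r [c [x [_ Xx ->]]]] [r' [c' [x' [_ Xx' ->]]]].
  exists (r + r')%N, (fun i => match split i with inl j => c j | inr j => c' j end),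
    (fun i => match split i with inl j => x j | inr j => x' j end).
  split=> // [i|]; first by case: (split i).
  rewrite big_split_ord; congr (_ + _); apply: eq_bigr => i _.
    by rewrite (unsplitK (inl i)).
  by rewrite (unsplitK (inr i)).
- move=> a _ [r [c [x [_ Xx ->]]]]; exists r, (fun i => a * c i), x; split=> //.
  by rewrite mulr_sumr; apply: eq_bigr => i _; rewrite mulrA.
Qed.

Lemma sub_ideal_gen X : X `<=` ideal_gen X.
Proof.
move=> x Xx; exists 1%N, (fun=> 1), (fun=> x); split=> //.
by rewrite big_ord1 mul1r.
Qed.

Lemma ideal_gen_min X I : is_ideal I -> X `<=` I -> ideal_gen X `<=` I.
Proof.
move=> idI XI _ [r [c [x [_ Xx ->]]]].
by apply: ideal_sum_in => // i _; apply: idealMl => //; apply: XI.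
Qed.

Lemma ideal_gen_mono X Y : X `<=` Y -> ideal_gen X `<=` ideal_gen Y.
Proof.
move=> XY; apply: ideal_gen_min; first exact: is_ideal_gen.
by move=> x /XY; apply: sub_ideal_gen.
Qed.

Lemma is_ideal_colon I x : is_ideal I -> is_ideal [set a | I (a * x)].
Proof.
move=> idI; split=> [|a b|a b] /=; first by rewrite mul0r; apply: ideal0.
  by rewrite mulrDl; apply: idealD.
by rewrite -mulrA; apply: idealMl.
Qed.

(** The ideal I + (f), in a form from which the coefficient of f can be read off. *)
Definition adjoin I f : set A := [set x | exists a, I (x - a * f)].

Lemma is_ideal_adjoin I f : is_ideal I -> is_ideal (adjoin I f).
Proof.
move=> idI; split.
- by exists 0; rewrite mul0r subr0; apply: ideal0.
- move=> x y [a Ia] [b Ib]; exists (a + b).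
  rewrite (_ : _ - _ = (x - a * f) + (y - b * f)); last by ring.
  exact: idealD.
- move=> c x [a Ia]; exists (c * a).
  rewrite (_ : _ - _ = c * (x - a * f)); last by ring.
  exact: idealMl.
Qed.

Lemma sub_adjoin I f : is_ideal I -> I `<=` adjoin I f.
Proof. by move=> idI x Ix; exists 0; rewrite mul0r subr0. Qed.

Lemma mem_adjoin I f : is_ideal I -> adjoin I f f.
Proof. by move=> idI; exists 1; rewrite mul1r subrr; apply: ideal0. Qed.

Lemma is_ideal_power I n : is_ideal (ideal_power I n).
Proof. exact: is_ideal_gen. Qed.

Lemma ideal_power0 I x : ideal_power I 0 x.
Proof.
apply: ideal_all; first exact: is_ideal_power.
by apply: sub_ideal_gen; exists (fun=> 0); [case|rewrite big_ord0].
Qed.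

Lemma ideal_powerS_mul I n x y : 
  I x -> ideal_power I n y -> ideal_power I n.+1 (x * y).
Proof.
move=> Ix.
apply: (ideal_gen_min (I := [set y | ideal_power I n.+1 (x * y)])).
  have := is_ideal_colon x (is_ideal_power I n.+1).
  by under eq_set do rewrite mulrC.
move=> _ [u Iu ->] /=; apply: sub_ideal_gen.
exists (fun i => if unlift ord0 i is Some j then u j else x).
  by move=> i; case: unliftP.
rewrite big_ord_recl unlift_none; congr (_ * _).
by apply: eq_bigr => i _; rewrite liftK.
Qed.

Lemma ideal_powerS_min I n K : is_ideal K ->
  (forall x y, I x -> ideal_power I n y -> K (x * y)) -> ideal_power I n.+1 `<=` K.
Proof.
move=> idK IK; apply: ideal_gen_min => // _ [u Iu ->].
rewrite big_ord_recl; apply: IK; first exact: Iu.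
by apply: sub_ideal_gen; exists (fun i => u (lift ord0 i)).
Qed.

Lemma ideal_power1 I : is_ideal I -> ideal_power I 1 = I.
Proof.
move=> idI; apply/seteqP; split; first by apply: ideal_powerS_min => // x y Ix _; apply: idealMr.
move=> x Ix; rewrite -(mulr1 x); apply: ideal_powerS_mul => //.
exact: ideal_power0.
Qed.

Lemma ideal_power_mul I m n x y :
  ideal_power I m x -> ideal_power I n y -> ideal_power I (m + n) (x * y).
Proof.
elim: m x => [|m IHm] x.
  by move=> _ Iy; apply: idealMl => //; apply: is_ideal_power.
move=> Ix Iy; move: x Ix; apply: ideal_powerS_min.
  by apply: is_ideal_colon; apply: is_ideal_power.
by move=> x z Ix Iz /=; rewrite -mulrA; apply: ideal_powerS_mul => //; apply: IHm.
Qed.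

Lemma ideal_powerW I m n : (m <= n)%N -> ideal_power I n `<=` ideal_power I m.
Proof.
move=> /subnK <- x; elim: (n - m)%N x => // j IHj; apply: ideal_powerS_min.
  exact: is_ideal_power.
by move=> x y _ Iy; apply: idealMl; [apply: is_ideal_power|apply: IHj].
Qed.

Lemma ideal_power_exp I n x : I x -> ideal_power I n (x ^+ n).
Proof.
move=> Ix; elim: n => [|n IHn]; first exact: ideal_power0.
by rewrite exprS; apply: ideal_powerS_mul.
Qed.

Lemma prime_ideal P : is_prime_ideal P -> is_ideal P. Proof. by case. Qed.

Lemma prime_not1 P : is_prime_ideal P -> ~ P 1. Proof. by case. Qed.

Lemma prime_mulN P s t : is_prime_ideal P -> ~ P s -> ~ P t -> ~ P (s * t).
Proof. by case=> _ _ prP nPs nPt /prP []. Qed.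

Lemma prime_prodN P (S : eqType) (r : seq S) (F : S -> A) : is_prime_ideal P ->
  (forall i, i \in r -> ~ P (F i)) -> ~ P (\prod_(i <- r) F i).
Proof.
move=> prP nPF; elim: r nPF => [|i r IHr] nPF; first by rewrite big_nil; apply: prime_not1.
rewrite big_cons; apply: prime_mulN => //; first by apply: nPF; rewrite mem_head.
by apply: IHr => j rj; apply: nPF; rewrite inE rj orbT.
Qed.

Lemma prime_exp P a n : is_prime_ideal P -> P (a ^+ n) -> P a.
Proof.
move=> prP; elim: n => [|n IHn]; first by rewrite expr0 => /(prime_not1 prP).
by rewrite exprS; case: (prP) => _ _ mulP /mulP [].
Qed.

End Ideals.

Lemma rmorph_ideal_power (C T : comNzRingType) (e : {rmorphism C -> T})
    (X : set C) (U : set T) i x :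
  (forall y, X y -> U (e y)) -> ideal_power X i x -> ideal_power U i (e x).
Proof.
move=> XU; elim: i x => [|i IHi] x; first by move=> _; apply: ideal_power0.
move: x; apply: ideal_powerS_min => [|x y Xx /IHi Uy].
  have idU := is_ideal_power U i.+1.
  split=> [|x y|a x]; rewrite ?rmorph0 ?rmorphD ?rmorphM.
  - exact: ideal0.
  - exact: idealD.
  - exact: idealMl.
by rewrite rmorphM; apply: ideal_powerS_mul => //; apply: XU.
Qed.

(** * Associated primes, primary ideals and symbolic powers *)

(** Noetherianity as the maximum condition, as used in noetherian induction. *)
Definition noetherian (A : comNzRingType) :=
  forall C : set (set A), C !=set0 -> (forall I, C I -> is_ideal I) ->
  exists2 I, C I & forall J, C J -> I `<=` J -> J `<=` I.

Section Coprimary.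

Variable A : comNzRingType.
Hypothesis noethA : noetherian A.
Implicit Types (I F E P X Y : set A) (a b f g h s t x y z : A).

(** A proper annihilator of a multiple of x, maximal among those, is prime. *)
Lemma ass_above I x : is_ideal I -> ~ I x ->
  exists2 P, Ass I P & [set a | I (a * x)] `<=` P.
Proof.
move=> idI nIx.
pose C := [set F | exists2 r, ~ I (r * x) & F = [set a | I (a * (r * x))]].
have [] := noethA (C := C).
- by exists [set a | I (a * x)]; exists 1; rewrite mul1r.
- by move=> _ [r _ ->]; apply: is_ideal_colon.
move=> _ [r nIrx ->] maxP; exists [set a | I (a * (r * x))]; last first.
  by move=> a /= Iax; rewrite mulrCA; apply: idealMl.
split; last by exists (r * x).
split; [exact: is_ideal_colon|by rewrite /= mul1r|].
move=> a b /= Iab; have [|nIb] := pselect (I (b * (r * x))); first by right.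
left; apply: (maxP [set c | I (c * (b * r * x))]); rewrite /=.
- by exists (b * r); rewrite // -mulrA.
- by move=> c /= Ic; rewrite -mulrA mulrCA; apply: idealMl.
- by rewrite -(mulrA b) mulrA.
Qed.

Lemma ass_prime I P : Ass I P -> is_prime_ideal P. Proof. by case. Qed.

(** For a prime P, an ideal is saturated when it is contracted from the
    localization at P. *)
Definition saturated P F := forall s x, ~ P s -> F (s * x) -> F x.

Definition nilpotent_mod P F := forall a, P a -> exists n, F (a ^+ n).

(** For a prime P, these are the P-primary ideals together with the unit ideal,
    which is kept because the enlargements made in a noetherian induction may
    reach it. *)
Record coprimary P F : Prop := Coprimary {
  coprimary_ideal : is_ideal F;
  coprimary_sat : saturated P F;
  coprimary_nil : nilpotent_mod P F }.

(** The contraction to A of the extension of F to the localization at P. *)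
Definition saturation P F : set A := [set x | exists2 s, ~ P s & F (s * x)].

Lemma is_ideal_saturation P F : is_prime_ideal P -> is_ideal F ->
  is_ideal (saturation P F).
Proof.
move=> prP idF; split.
- by exists 1; [apply: prime_not1|rewrite mulr0; apply: ideal0].
- move=> x y [s nPs Fsx] [t nPt Fty]; exists (s * t); first exact: prime_mulN.
  rewrite (_ : s * t * (x + y) = t * (s * x) + s * (t * y)); last by ring.
  by apply: idealD => //; apply: idealMl.
- by move=> a x [s nPs Fsx]; exists s => //; rewrite mulrCA; apply: idealMl.
Qed.

Lemma sub_saturation P F : is_prime_ideal P -> F `<=` saturation P F.
Proof. by move=> prP x Fx; exists 1; [apply: prime_not1|rewrite mul1r]. Qed.

Lemma saturation_saturated P F : is_prime_ideal P -> saturated P (saturation P F).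
Proof.
by move=> prP s x nPs [t nPt]; rewrite mulrA => Fx; exists (t * s) => //; apply: prime_mulN.
Qed.

Lemma saturation_coprimary P F E : is_prime_ideal P -> coprimary P F -> is_ideal E ->
  F `<=` E -> coprimary P (saturation P E).
Proof.
move=> prP [_ _ nilF] idE FE; split; first exact: is_ideal_saturation.
  exact: saturation_saturated.
by move=> a /nilF [n /FE Ean]; exists n; apply: sub_saturation.
Qed.

(** By nilpotence, an associated prime of F contains P; by saturation, it is
    contained in P. *)
Lemma coprimary_colon P F : is_prime_ideal P -> coprimary P F -> ~ F 1 ->
  exists f, P = [set a | F (a * f)].
Proof.
move=> prP [idF satF nilF] nF1; have [Q [prQ [f Qf]] _] := ass_above idF nF1.
exists f; rewrite -Qf; apply/seteqP; split=> a.
  by move=> /nilF [n Fan]; apply: (prime_exp (n := n)) => //; rewrite Qf /=; apply: idealMr.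
rewrite Qf /= => Faf; apply: contrapT => /satF /(_ Faf) Ff.
by apply: (prime_not1 prQ); rewrite Qf /= mul1r.
Qed.

(** A saturated ideal is an intersection of primary ideals. A saturated E that
    is maximal among those avoiding f works: every ideal strictly larger than E
    contains a multiple s f with s outside P. For a in P this gives first
    a f in E, as in Nakayama's lemma, and then, applied to E + (a^m) with
    (E : a^m) = (E : a^(m+1)), that a^m is in E. *)
Lemma coprimary_avoiding P F f : is_prime_ideal P -> is_ideal F -> saturated P F ->
  ~ F f -> exists E, [/\ coprimary P E, F `<=` E & ~ E f].
Proof.
move=> prP idF satF nFf.
have [] := noethA (C := [set E | [/\ is_ideal E, saturated P E, F `<=` E & ~ E f]]).
- by exists F; split.
- by move=> I [].
move=> E [idE satE FE nEf] maxE.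
have in_sat G x : is_ideal G -> E `<=` G -> G x -> ~ E x -> saturation P G f.
  move=> idG EG Gx nEx; apply: contrapT => nGf; apply: nEx.
  apply: (maxE (saturation P G)); last by apply: sub_saturation.
    split=> //; first exact: is_ideal_saturation.
      exact: saturation_saturated.
    by move=> z /FE /EG; apply: sub_saturation.
  by move=> z /EG; apply: sub_saturation.
have Paf a : P a -> E (a * f).
  move=> Pa; apply: contrapT => nEaf.
  have [|||s nPs [c Es]] := in_sat (adjoin E (a * f)) (a * f) _ _ _ nEaf.
  - exact: is_ideal_adjoin.
  - exact: sub_adjoin.
  - exact: mem_adjoin.
  apply: nEf; apply: (satE (s - c * a)).
    move=> Psca; apply: nPs; rewrite -(subrK (c * a) s).
    by apply: idealD (prime_ideal prP) Psca _; apply: idealMl (prime_ideal prP) Pa.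
  by rewrite mulrBl -(mulrA c).
exists E; split=> //; split=> // a Pa.
pose C := [set G | exists n, G = [set x | E (x * a ^+ n)]].
have [] := noethA (C := C).
- by exists [set x | E (x * a ^+ 0)]; exists 0%N.
- by move=> _ [n ->]; apply: is_ideal_colon.
move=> _ [m ->] maxm; exists m; apply: contrapT => nEm.
have [|||s nPs [c Es]] := in_sat (adjoin E (a ^+ m)) (a ^+ m) _ _ _ nEm.
- exact: is_ideal_adjoin.
- exact: sub_adjoin.
- exact: mem_adjoin.
apply: nEf; apply: (satE s) => //; apply: (idealBr idE Es).
apply: (maxm [set x | E (x * a ^+ m.+1)]) => /=.
- by exists m.+1.
- by move=> x /= Ex; rewrite exprS mulrCA; apply: idealMl.
- have := idealMl a idE Es; rewrite mulrBr => /(idealN idE); rewrite opprB => Ea.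
  rewrite exprS mulrCA; apply: (idealBr idE Ea).
  by rewrite mulrCA; apply: idealMl => //; apply: Paf.
Qed.

End Coprimary.

Section Symbolic.

Variable A : idomainType.
Implicit Types (I P X : set A) (f s x : A).

Lemma clear_denominator (F : fieldType) (t s a y z : F) : t != 0 ->
  t * s * (a / t * y + z) = s * a * y + t * (s * z).
Proof. by move=> t0; field. Qed.

(** Bring the fractions over a common denominator, which stays outside P. *)
Lemma extensionP P I f : is_prime_ideal P -> is_ideal I ->
  extension P I (tofrac f) <-> exists2 s, ~ P s & I (s * f).
Proof.
move=> prP idI; have nP0 s : ~ P s -> tofrac s != 0.
  move=> nPs; rewrite tofrac_eq0; apply/eqP => s0; apply: nPs.
  by rewrite s0; apply: ideal0; apply: prime_ideal.
split; last first.
  move=> [s nPs Isf]; exists 1%N, (fun=> 1 / tofrac s), (fun=> tofrac (s * f)).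
  split=> [_|_|]; first by exists 1, s; rewrite tofrac1.
    by exists (s * f).
  by rewrite big_ord1 tofracM mul1r mulKf ?nP0.
move=> [r [c [x [Lc Ix fE]]]].
suff [s [z [nPs Iz szE]]] : exists s z, 
    [/\ ~ P s, I z & tofrac s * \sum_(i < r) c i * x i = tofrac z].
  exists s => //; move: szE; rewrite -fE -tofracM => /eqP.
  by rewrite tofrac_eq => /eqP ->.
move: Lc Ix {fE}.
elim: r c x => [|r IHr] c x Lc Ix.
  exists 1, 0; rewrite big_ord0 mulr0 tofrac0; split=> //; first exact: prime_not1.
  exact: ideal0.
have [s [z [nPs Iz szE]]] := IHr _ _ (fun i => Lc (lift ord0 i)) (fun i => Ix (lift ord0 i)).
have [a [t [nPt cE]]] := Lc ord0; have [y Iy xE] := Ix ord0.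
exists (t * s), (s * a * y + t * z); split; first exact: prime_mulN.
  by apply: idealD => //; apply: idealMl.
rewrite big_ord_recl cE -xE tofracD !tofracM -szE.
exact: clear_denominator (nP0 _ nPt).
Qed.

Lemma symbolic_powerP I n f : symbolic_power I n f <->
  forall P, Ass I P -> exists2 s, ~ P s & ideal_power I n (s * f).
Proof.
split=> sf P aP; first by apply/extensionP;
  [exact: ass_prime aP|exact: is_ideal_power|exact: sf].
apply: (extensionP _ (ass_prime aP) (is_ideal_power I n)).2; exact: sf.
Qed.

Lemma is_ideal_symbolic_power I n : is_ideal (symbolic_power I n).
Proof.
split=> [|x y|a x].
- by apply/symbolic_powerP => P aP; apply: (ideal0 (is_ideal_saturation (ass_prime aP) (is_ideal_power I n))).
- move=> /symbolic_powerP Ix /symbolic_powerP Iy; apply/symbolic_powerP => P aP.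
  exact: (idealD (is_ideal_saturation (ass_prime aP) (is_ideal_power I n)) (Ix P aP) (Iy P aP)).
- move=> /symbolic_powerP Ix; apply/symbolic_powerP => P aP.
  exact: (idealMl a (is_ideal_saturation (ass_prime aP) (is_ideal_power I n)) (Ix P aP)).
Qed.

Lemma ideal_power_sub_symbolic I n : ideal_power I n `<=` symbolic_power I n.
Proof.
move=> f If; apply/symbolic_powerP => P aP.
by exists 1; [apply: prime_not1; apply: ass_prime aP|rewrite mul1r].
Qed.

(** An element outside I has an annihilator modulo I inside some associated
    prime, so it is outside I locally at that prime. *)
Lemma symbolic_power1 I : noetherian A -> is_ideal I -> symbolic_power I 1 `<=` I.
Proof.
move=> noeth idI f /symbolic_powerP If; apply: contrapT => nIf.
have [P aP IP] := ass_above noeth idI nIf; have [s nPs] := If P aP.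
by rewrite ideal_power1 // => /IP.
Qed.

Lemma symbolic_powerW I m n : (m <= n)%N -> symbolic_power I n `<=` symbolic_power I m.
Proof.
move=> mn f /symbolic_powerP If; apply/symbolic_powerP => P /If [s nPs Isf].
by exists s => //; apply: ideal_powerW Isf.
Qed.

Lemma symbolic_power_separation I n f : noetherian A -> is_ideal I -> ~ symbolic_power I n f ->
  exists P E, [/\ Ass I P, coprimary P E, ideal_power I n `<=` E & ~ E f].
Proof.
move=> noeth idI /symbolic_powerP /existsNP [P /not_implyP [aP nIf]].
have prP := ass_prime aP.
have [||E [cE IE nEf]] := coprimary_avoiding (f := f) noeth prP
  (is_ideal_saturation prP (is_ideal_power I n)).
- exact: saturation_saturated.
- by move=> [s nPs Is]; apply: nIf; exists s.
by exists P, E; split=> // x Ix; apply: IE; apply: sub_saturation.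
Qed.

Lemma symbolic_power_coprimary I n P E : Ass I P -> coprimary P E ->
  ideal_power I n `<=` E -> symbolic_power I n `<=` E.
Proof.
move=> aP [_ satE _] IE f /symbolic_powerP /(_ _ aP) [s nPs /IE].
exact: satE.
Qed.

End Symbolic.

(** * The polynomial ring is noetherian, and has normal forms modulo an ideal *)

(** Choose repeatedly an index where the minimum of the remaining values is
    attained. *)
Lemma nondecreasing_subsequence (u : nat -> nat) :
  exists2 g : nat -> nat, {homo g : i j / (i < j)%N} &
    {homo u \o g : i j / (i <= j)%N}.
Proof.
have argmin N : exists j, (N <= j)%N /\ forall i, (N <= i)%N -> (u j <= u i)%N.
  have [] := @ex_minnP [pred v | `[< exists2 j, (N <= j)%N & u j = v >]].
    by exists (u N); apply/asboolP; exists N.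
  move=> v /asboolP [j Nj <-] minj; exists j; split=> // i Ni.
  by apply: minj; apply/asboolP; exists i.
have [m mP] := choice argmin.
pose g := fix g i := m (if i is i'.+1 then (g i').+1 else 0%N).
have gP i : forall j, (g i <= j)%N -> (u (g i) <= u j)%N.
  move=> j gij; case: i gij => [|i] gij.
    by apply: (mP _).2.
  by apply: (mP _).2; apply: leq_trans gij; apply: (mP _).1.
have g_lt : {homo g : i j / (i < j)%N}.
  by apply: homo_ltn => [? ? ?|i]; [exact: ltn_trans|apply: (mP _).1].
exists g => // i j; rewrite leq_eqVlt => /predU1P [->//|/g_lt gij].
by apply: gP; apply: ltnW.
Qed.

(** Dickson's lemma, by passing to a nondecreasing subsequence one coordinate
    after the other. *)
Lemma dickson n (u : nat -> 'X_{1..n}) :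
  exists i j, (i < j)%N /\ (u i <= u j)%MM.
Proof.
suff [g g_lt gP] : exists2 g : nat -> nat, {homo g : i j / (i < j)%N} &
    forall c, c \in enum 'I_n -> {homo (fun i => u (g i) c) : i j / (i <= j)%N}.
  exists (g 0%N), (g 1%N); split; first exact: g_lt.
  by apply/mnm_lepP => c; apply: (gP c) => //; rewrite mem_enum.
elim: (enum _) => [|c s [g g_lt gP]]; first by exists id.
have [h h_lt hP] := nondecreasing_subsequence (fun i => u (g i) c).
exists (g \o h) => [i j ij|d]; first by apply: g_lt; apply: h_lt.
rewrite inE => /predU1P [->|/gP gd i j] //=.
rewrite leq_eqVlt => /predU1P [->//|/h_lt hij].
by apply: gd; apply: ltnW.
Qed.

Section LeadingMonomials.

Variables (k : fieldType) (n : nat).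
Local Notation A := {mpoly k[n]}.
Implicit Types (I J : set A) (f g : A) (m : 'X_{1..n}).

Definition lead_set I : set 'X_{1..n} := [set m | exists2 f, I f /\ f != 0 & mlead f = m].

(** One step of the division algorithm. *)
Lemma mlead_cancel f g : g != 0 -> mlead f = mlead g ->
  let h := f - f@_(mlead f) / g@_(mlead g) *: g in h = 0 \/ (mlead h < mlead f)%O.
Proof.
move=> g0 fg /=; set h := f - _; case: (eqVneq h 0) => [|h0]; [by left|right].
have hf : h@_(mlead f) = 0.
  by rewrite mcoeffB mcoeffZ fg divfK ?subrr ?mleadc_eq0 //.
have le : (mlead h <= mlead f)%O.
  apply: le_trans (mleadB_le _ _) _; rewrite leUx lexx /= fg.
  exact: mleadZ_le.
rewrite lt_neqAle le andbT; apply: contraNneq h0 => hE.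
by rewrite -mleadc_eq0 hE hf.
Qed.

Lemma idealZ I c f : is_ideal I -> I f -> I (c *: f).
Proof. by move=> idI If; rewrite -mul_mpolyC; apply: idealMl. Qed.

Lemma lead_set_inj I J : is_ideal I -> is_ideal J -> I `<=` J ->
  lead_set J `<=` lead_set I -> J `<=` I.
Proof.
move=> idI idJ IJ JI f; elim/mleadrect: f => f IHf Jf.
have [->|f0] := eqVneq f 0; first exact: ideal0.
have [|g [Ig g0] gf] := JI (mlead f); first by exists f.
pose h := f - f@_(mlead f) / g@_(mlead g) *: g.
have Jh : J h by apply: idealB => //; apply: idealZ => //; apply: IJ.
suff Ih : I h by apply: (idealBr idI Ih); apply: idealZ.
have : h = 0 \/ (mlead h < mlead f)%O by apply: mlead_cancel.
by move=> [->|/IHf]; [apply: ideal0|apply].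
Qed.

Lemma mpolyX_neq0 m : 'X_[m] != 0 :> A.
Proof. by rewrite -mleadc_eq0 mleadXm mcoeffX eqxx oner_eq0. Qed.

Lemma lead_set_up I m m' : is_ideal I -> (m <= m')%MM -> lead_set I m -> lead_set I m'.
Proof.
move=> idI mm' [f [If f0] fm]; have X0 := mpolyX_neq0 (m' - m)%MM.
exists ('X_[m' - m] * f); first by split; [apply: idealMl|rewrite mulf_neq0].
by rewrite mleadM // mleadXm fm submK.
Qed.

(** Without a maximal element there would be a strictly increasing chain of
    ideals. Their sets of leading monomials would increase strictly too, and a
    monomial chosen from each strict increase would contradict Dickson's
    lemma. *)
Theorem mpoly_noetherian : noetherian A.
Proof.
move=> C [I0 CI0] idC; apply: contrapT => noMax.
have next (I : {I | C I}) : exists J : {I | C I}, sval I `<=` sval J /\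
    exists2 m, lead_set (sval J) m & ~ lead_set (sval I) m.
  apply: contrapT => noJ; apply: noMax; exists (sval I); first exact: svalP.
  move=> J CJ IJ; apply: (lead_set_inj (idC _ (svalP I)) (idC _ CJ) IJ).
  move=> m Jm; apply: contrapT => nIm; apply: noJ.
  by exists (exist _ J CJ); split=> //; exists m.
have [F FP] := choice next.
pose G := fix G i := if i is i'.+1 then F (G i') else exist _ I0 CI0.
have G_mono i j : (i <= j)%N -> sval (G i) `<=` sval (G j).
  move=> /subnKC <-; elim: (j - i)%N => [|d IHd]; first by rewrite addn0.
  by rewrite addnS => f /IHd; apply: (FP _).1.
have {}next i : exists m, lead_set (sval (G i.+1)) m /\ ~ lead_set (sval (G i)) m.
  by have [_ [m ? ?]] := FP (G i); exists m.
have [u uP] := choice next; have [i [j [ij uij]]] := dickson u.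
apply: (uP j).2; apply: (lead_set_up _ uij); first exact: idC _ (svalP _).
by have [f [/(G_mono _ _ ij) Gf f0] fu] := (uP i).1; exists f.
Qed.

(** The monomials that are not leading in I form a k-basis of the ring modulo I;
    a normal form is a combination of them. *)
Lemma normal_form_ex I f : is_ideal I ->
  exists g, I (f - g) /\ forall m, lead_set I m -> g@_m = 0.
Proof.
move=> idI; elim/mleadrect: f => f IHf.
have [->|f0] := eqVneq f 0.
  by exists 0; rewrite subrr; split=> [|m _]; [apply: ideal0|rewrite mcoeff0].
have step h c : f = c + h -> h = 0 \/ (mlead h < mlead f)%O ->
    exists g, I (h - g) /\ forall m, lead_set I m -> g@_m = 0.
  move=> _ [->|/IHf //]; exists 0; rewrite subrr.
  by split=> [|m _]; [apply: ideal0|rewrite mcoeff0].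
have [[g [Ig g0] gf]|nIf] := pselect (lead_set I (mlead f)).
  have [|r [Ir rP]] := step _ (f@_(mlead f) / g@_(mlead g) *: g) _ (mlead_cancel g0 (esym gf)).
    by rewrite addrC subrK.
  exists r; split=> //; apply: (idealBr idI (y := f@_(mlead f) / g@_(mlead g) *: g)).
    by rewrite addrAC.
  exact: idealZ.
have X0 := mpolyX_neq0 (mlead f).
have [|r [Ir rP]] := step _ (f@_(mlead f) *: 'X_[mlead f]) _
   (mlead_cancel X0 (esym (mleadXm _ (mlead f)))).
  by rewrite mleadXm mcoeffX eqxx divr1 addrC subrK.
move: Ir; rewrite mleadXm mcoeffX eqxx divr1 => Ir.
exists (f@_(mlead f) *: 'X_[mlead f] + r); split; first by rewrite opprD addrA.
move=> m Im; rewrite mcoeffD rP // mcoeffZ mcoeffX.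
by case: eqVneq => [fm|_]; [rewrite -fm in Im|rewrite mulr0 addr0].
Qed.

Lemma normal_form_eq0 I g : I g -> (forall m, lead_set I m -> g@_m = 0) -> g = 0.
Proof.
move=> Ig gP; apply/eqP; apply: contraT => g0.
by have := g0; rewrite -mleadc_eq0 gP ?eqxx //; exists g.
Qed.

Definition normal_form_spec I (f g : A) :=
  is_ideal I -> I (f - g) /\ forall m, lead_set I m -> g@_m = 0.

Lemma normal_form_spec_ex I f : exists g, normal_form_spec I f g.
Proof.
have [idI|nid] := pselect (is_ideal I); last by exists 0 => /nid.
by have [g gP] := normal_form_ex f idI; exists g.
Qed.

(** The k-linear projector with kernel I onto the span of the standard monomials. *)
Definition normal_form I f : A := sval (cid (normal_form_spec_ex I f)).

Variable I : set A.
Hypothesis idI : is_ideal I.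

Lemma normal_form_sub f : I (f - normal_form I f).
Proof. by rewrite /normal_form; case: cid => g /= [|]. Qed.

Lemma normal_form_uniq f g : I (f - g) -> (forall m, lead_set I m -> g@_m = 0) -> normal_form I f = g.
Proof.
move=> Ifg gP; apply/eqP; rewrite -subr_eq0; apply/eqP; apply: (@normal_form_eq0 I).
  by rewrite (_ : _ - _ = (f - g) - (f - normal_form I f)); [apply: idealB => //; apply: normal_form_sub|ring].
move=> m Im; rewrite mcoeffB gP // subr0 /normal_form; case: cid => h /= [|_] //; exact.
Qed.

Lemma normal_form_lead f m : lead_set I m -> (normal_form I f)@_m = 0.
Proof. by rewrite /normal_form; case: cid => g /= [|_] //; apply. Qed.

Lemma normal_formD f g : normal_form I (f + g) = normal_form I f + normal_form I g.
Proof.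
apply: normal_form_uniq => [|m Im]; last by rewrite mcoeffD !normal_form_lead ?addr0.
rewrite (_ : _ - _ = (f - normal_form I f) + (g - normal_form I g)); last by ring.
by apply: idealD => //; apply: normal_form_sub.
Qed.

Lemma normal_formZ c f : normal_form I (c *: f) = c *: normal_form I f.
Proof.
apply: normal_form_uniq => [|m Im]; last by rewrite mcoeffZ normal_form_lead ?mulr0.
by rewrite -scalerBr; apply: idealZ => //; apply: normal_form_sub.
Qed.

Lemma normal_form0P f : normal_form I f = 0 <-> I f.
Proof.
split=> [f0|If]; first by have := normal_form_sub f; rewrite f0 subr0.
by apply: normal_form_uniq => [|m _]; rewrite ?subr0 ?mcoeff0.
Qed.

End LeadingMonomials.

(** * Ideals in a tensor product of polynomial rings *)

Section Tensor.

Variable k : fieldType.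

Section Def.
Variables (n p : nat) (T : comNzRingType).
Local Notation A := {mpoly k[n]}.
Local Notation B := {mpoly k[p]}.

(** T is the tensor product of A and B over k, stated by its universal property
    so that the two factors play symmetric roles and every lemma below applies
    after [tensor_swap] to the other factor. *)
Record is_tensor (eL : A -> T) (eR : B -> T) : Prop := IsTensor {
  tensor_const : forall c : k, eL c%:MP = eR c%:MP;
  tensor_gen : forall K : set T, (forall x y, K x -> K y -> K (x + y)) ->
    (forall f g, K (eL f * eR g)) -> forall t, K t;
  tensor_lift : forall (V : zmodType) (b : A -> B -> V),
    (forall f f' g, b (f + f') g = b f g + b f' g) ->
    (forall f g g', b f (g + g') = b f g + b f g') ->
    (forall c f g, b (c *: f) g = b f (c *: g)) ->
    exists L : T -> V, (forall x y, L (x + y) = L x + L y) /\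
      forall f g, L (eL f * eR g) = b f g }.

End Def.

Lemma tensor_swap n p (T : comNzRingType) (eL : {mpoly k[n]} -> T) (eR : {mpoly k[p]} -> T) :
  is_tensor eL eR -> is_tensor eR eL.
Proof.
move=> [tc tg tl]; split=> [c|K KD KM|V b bDl bDr bZ]; first by rewrite tc.
  by apply: tg => // f g; rewrite mulrC; apply: KM.
have [|||L [LD LM]] := tl V (fun f g => b g f) => //.
by exists L; split=> // f g; rewrite mulrC LM.
Qed.

Variables (n p : nat) (T : comNzRingType).
Local Notation A := {mpoly k[n]}.
Local Notation B := {mpoly k[p]}.
Variables (eL : {rmorphism A -> T}) (eR : {rmorphism B -> T}).
Hypothesis tensT : is_tensor eL eR.
Implicit Types (F I E P : set A) (G J Q : set B) (K U : set T).
Implicit Types (a f s : A) (b g : B) (h t x y : T).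

Definition tensor_sum F G : set T := ideal_gen (eL @` F `|` eR @` G).

Lemma is_ideal_tensor_sum F G : is_ideal (tensor_sum F G). Proof. exact: is_ideal_gen. Qed.

Lemma tensor_sumL F G f t : F f -> tensor_sum F G (eL f * t).
Proof. by move=> Ff; apply: idealMr; [apply: is_ideal_tensor_sum|apply: sub_ideal_gen; left; exists f]. Qed.

Lemma tensor_sumR F G g t : G g -> tensor_sum F G (t * eR g).
Proof. by move=> Gg; apply: idealMl; [apply: is_ideal_tensor_sum|apply: sub_ideal_gen; right; exists g]. Qed.

Lemma tensor_sum_min F G K : is_ideal K -> (forall f, F f -> K (eL f)) -> (forall g, G g -> K (eR g)) ->
  tensor_sum F G `<=` K.
Proof. by move=> idK FK GK; apply: ideal_gen_min => // _ [[f Ff <-]|[g Gg <-]]; auto. Qed.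

Lemma tensor_sum_mono F F' G G' : F `<=` F' -> G `<=` G' -> tensor_sum F G `<=` tensor_sum F' G'.
Proof. by move=> FF GG; apply: ideal_gen_mono; apply: setUSS; apply: image_subset. Qed.

Lemma tensor_scale c f t : eL (c *: f) * t = eR c%:MP * (eL f * t).
Proof. by rewrite -mul_mpolyC rmorphM (tensor_const tensT) mulrA. Qed.

Lemma tensor_balanced c f g : eL (c *: f) * eR g = eL f * eR (c *: g).
Proof. by rewrite tensor_scale mulrCA -rmorphM mul_mpolyC. Qed.

(** Additive induction over a generated ideal, where the coefficients can be
    taken to be pure tensors. *)
Lemma tensor_ideal_ind (X K : set T) : K 0 -> (forall x y, K x -> K y -> K (x + y)) ->
  (forall a b x, X x -> K (eL a * eR b * x)) -> ideal_gen X `<=` K.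
Proof.
move=> K0 KD KM _ [r [c [x [_ Xx ->]]]]; elim/big_ind: _ => // i _.
by apply: (tensor_gen tensT (K := [set t | K (t * x i)])) => [u v|f g] /=;
  [rewrite mulrDl; apply: KD|apply: KM].
Qed.

(** The coordinates, with values in A, of an element of T modulo G along the
    standard monomials of B modulo G. They turn membership in F + G into
    membership in F (lemmas [slice_of_tensor_sum] and [mem_tensor_sum]). *)
Record is_slicing (G : set B) (c : 'X_{1..p} -> T -> A) : Prop := IsSlicing {
  sliceD : forall m x y, c m (x + y) = c m x + c m y;
  sliceM : forall m f g, c m (eL f * eR g) = (normal_form G g)@_m *: f }.

Lemma slicing_ex G : is_ideal G -> exists c, is_slicing G c.
Proof.
move=> idG.
have /choice [c cP] (m : 'X_{1..p}) : exists L : T -> A,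
    (forall x y, L (x + y) = L x + L y) /\
    forall f g, L (eL f * eR g) = (normal_form G g)@_m *: f.
  apply: (tensor_lift tensT) => [f f' g|f g g'|d f g].
  - by rewrite scalerDr.
  - by rewrite normal_formD // mcoeffD scalerDl.
  - by rewrite normal_formZ // mcoeffZ scalerA mulrC.
by exists c; split=> [m x y|m f g]; [rewrite (cP m).1|rewrite (cP m).2].
Qed.

Section Slices.
Variables (G : set B) (c : 'X_{1..p} -> T -> A).
Hypotheses (idG : is_ideal G) (slc : is_slicing G c).

Lemma slice0 m : c m 0 = 0.
Proof. by apply: (addIr (c m 0)); rewrite -(sliceD slc) !add0r. Qed.

Lemma slice_mulL m a h : c m (eL a * h) = a * c m h.
Proof.
apply: (tensor_gen tensT (K := [set h | c m (eL a * h) = a * c m h])) => [x y /= xE yE|f g /=].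
  by rewrite mulrDr !(sliceD slc) xE yE mulrDr.
by rewrite mulrA -rmorphM !(sliceM slc) scalerAr.
Qed.

Lemma slice_of_tensor_sum F h m : is_ideal F -> tensor_sum F G h -> F (c m h).
Proof.
move=> idF; move: h; apply: tensor_ideal_ind => /= [|x y Fx Fy|a b x].
- by rewrite slice0; apply: ideal0.
- by rewrite (sliceD slc); apply: idealD.
case=> [[f Ff <-]|[g Gg <-]].
  rewrite mulrAC -rmorphM (sliceM slc); apply: idealZ => //.
  exact: idealMl.
rewrite -mulrA -rmorphM (sliceM slc) (normal_form0P idG _).2 ?mcoeff0 ?scale0r; first exact: ideal0.
exact: idealMl.
Qed.

Lemma slice_decomposition h : exists N,
  (forall m, (N <= mdeg m)%N -> c m h = 0) /\
  forall N', (N <= N')%N ->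
    tensor_sum set0 G (h - \sum_(m : 'X_{1..p < N'}) eL (c m h) * eR 'X_[m]).
Proof.
move: h; apply: (tensor_gen tensT) => [x y [N1 [z1 s1]] [N2 [z2 s2]]|f g].
  exists (maxn N1 N2); split=> [m|N']; rewrite geq_max => /andP [le1 le2].
    by rewrite (sliceD slc) z1 // z2 // addr0.
  under eq_bigr do rewrite (sliceD slc) rmorphD mulrDl.
  rewrite big_split opprD addrACA; apply: idealD; first exact: is_ideal_tensor_sum.
    exact: s1.
  exact: s2.
exists (msize (normal_form G g)); split=> [m le|N' le].
  rewrite (sliceM slc); apply/eqP; rewrite scaler_eq0; apply/orP; left.
  by rewrite mcoeff_eq0; apply: msize_mdeg_ge.
under eq_bigr do rewrite (sliceM slc) tensor_balanced.
rewrite -mulr_sumr -rmorph_sum -mpolywE // -mulrBr -rmorphB.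
by apply: tensor_sumR; apply: normal_form_sub.
Qed.

Lemma mem_tensor_sum F h : (forall m, F (c m h)) -> tensor_sum F G h.
Proof.
move=> Fh; have [N [_ /(_ N (leqnn N)) hN]] := slice_decomposition h.
apply: (idealBr (is_ideal_tensor_sum F G) (y := \sum_(m : 'X_{1..p < N}) eL (c m h) * eR 'X_[m])).
  by move: hN; apply: tensor_sum_mono.
apply: ideal_sum_in => [|m _]; first exact: is_ideal_tensor_sum.
exact: tensor_sumL.
Qed.

End Slices.

Lemma tensor_sum_bigcap (S : Type) (D : set S) (F : S -> set A) G h : is_ideal G ->
  (forall i, D i -> is_ideal (F i)) ->
  (forall i, D i -> tensor_sum (F i) G h) -> tensor_sum (\bigcap_(i in D) F i) G h.
Proof.
move=> idG idF Fh; have [c slc] := slicing_ex idG.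
apply: (mem_tensor_sum idG slc) => m i Di.
by apply: (slice_of_tensor_sum idG slc) (Fh i Di); apply: idF.
Qed.

(** The annihilator of an element of A commutes with the flat extension to T. *)
Lemma tensor_sum_colon F G a h : is_ideal F -> is_ideal G ->
  tensor_sum F G (eL a * h) -> tensor_sum [set x | F (x * a)] G h.
Proof.
move=> idF idG Fh; have [c slc] := slicing_ex idG; apply: (mem_tensor_sum idG slc) => m /=.
by rewrite mulrC -(slice_mulL slc); apply: (slice_of_tensor_sum idG slc).
Qed.

Lemma tensor_sum_mulN F G f g : is_ideal F -> is_ideal G -> ~ F f -> ~ G g -> ~ tensor_sum F G (eL f * eR g).
Proof.
move=> idF idG nFf nGg Ffg; have [c slc] := slicing_ex idG.
apply: nGg; apply/(normal_form0P idG)/mpolyP => m; rewrite mcoeff0; apply/eqP.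
apply: contrapT => /negP g0; apply: nFf.
have := slice_of_tensor_sum idG slc m idF Ffg; rewrite (sliceM slc) => /(idealZ ((normal_form G g)@_m)^-1 idF).
by rewrite scalerA mulVf // scale1r.
Qed.

(** If P is the annihilator of h modulo I + J, an element a of A is in P exactly
    when it kills all coordinates of h modulo I. Almost all of them vanish, so
    the contraction is a finite intersection of annihilators modulo I, and being
    prime it equals one of them. *)
Lemma ass_contractL I J (P : set T) : is_ideal I -> is_ideal J -> Ass (tensor_sum I J) P ->
  Ass I [set a | P (eL a)].
Proof.
move=> idI idJ [prP [h PE]]; have [idP nP1 mulP] := prP.
have prp : is_prime_ideal [set a | P (eL a)].
  split; first split=> /= [|x y|a x]; rewrite ?rmorph0 ?rmorphD ?rmorphM.
  - exact: ideal0.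
  - exact: idealD.
  - exact: idealMl.
  - by rewrite /= rmorph1.
  - by move=> x y /=; rewrite rmorphM; apply: mulP.
split=> //; have [c slc] := slicing_ex idJ.
have PcP a : P (eL a) <-> forall m, I (a * c m h).
  rewrite {1}PE /=; split=> [Ia m|Ia].
    by rewrite -(slice_mulL slc); apply: (slice_of_tensor_sum idJ slc).
  by apply: (mem_tensor_sum idJ slc) => m; rewrite (slice_mulL slc).
have [N [cN _]] := slice_decomposition idJ slc h.
have [m Pm] : exists m : 'X_{1..p < N}, forall a, I (a * c m h) -> P (eL a).
  apply: contrapT => noM.
  have /choice [u uP] (m : 'X_{1..p < N}) : exists a, I (a * c m h) /\ ~ P (eL a).
    apply: contrapT => no; apply: noM; exists m => a Ia.
    by apply: contrapT => nPa; apply: no; exists a.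
  (* the product of elements killing one coordinate each kills h *)
  suff : P (eL (\prod_(m : 'X_{1..p < N}) u m)).
    by apply: (prime_prodN prp) => m _; apply: (uP m).2.
  apply/PcP => m; have [/cN ->|mN] := leqP N (mdeg m).
    by rewrite mulr0; apply: ideal0.
  rewrite (bigD1 (BMultinom mN)) //= mulrAC; apply: idealMr => //.
  exact: (uP (BMultinom mN)).1.
exists (c m h); apply/seteqP; split=> a /=; first by move/PcP; apply.
exact: Pm.
Qed.

Lemma tensor_sum_ass_colon I J P f h : is_ideal I -> is_ideal J -> 
  P = [set a | I (a * f)] -> tensor_sum I J (eL f * h) <-> tensor_sum P J h.
Proof.
move=> idI idJ ->; split; first exact: tensor_sum_colon.
move: h; apply: tensor_ideal_ind => [|x y Ix Iy|a b x [[u /= Iu <-]|[g Jg <-]]].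
- by rewrite mulr0; apply: ideal0; apply: is_ideal_tensor_sum.
- by rewrite mulrDr; apply: idealD => //; apply: is_ideal_tensor_sum.
- rewrite (_ : _ * _ = eL (u * f) * (eL a * eR b)); last by rewrite rmorphM; ring.
  exact: tensor_sumL.
- by rewrite mulrA; apply: tensor_sumR.
Qed.

(** Noetherian induction on F, by taking a largest counterexample. Let P = (F : f)
    and let E be the saturation of F + (f), so that E modulo F is torsion-free of
    rank one over A modulo P. If h is not in E + G, induction applies to E.
    Otherwise s h = r f modulo F + G for some s outside P, and multiplication by
    s, respectively by f, identifies the annihilator of h modulo F + G with that
    of r modulo P + G. *)
Lemma coprimary_colon_reduction P F G h : is_prime_ideal P -> coprimary P F -> is_ideal G ->
  ~ tensor_sum F G h ->
  exists2 r, ~ tensor_sum P G r & forall t, tensor_sum F G (t * h) -> tensor_sum P G (t * r).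
Proof.
move=> prP coF idG nFh; apply: contrapT => noR.
pose C := [set F | coprimary P F /\ exists2 h, ~ tensor_sum F G h &
  forall r, ~ tensor_sum P G r -> ~ forall t, tensor_sum F G (t * h) -> tensor_sum P G (t * r)].
have [] := mpoly_noetherian (C := C).
- exists F; split=> //; exists h => // r nPr rP; apply: noR; by exists r.
- by move=> E [[]].
move=> {coF nFh noR} {}F [coF [{}h nFh noR]] maxF.
have [idF satF nilF] := coF; have idP := prime_ideal prP.
have nF1 : ~ F 1.
  move=> F1; apply: nFh; rewrite -(mul1r h) -(rmorph1 eL); exact: tensor_sumL.
have [f PE] := coprimary_colon (@mpoly_noetherian k n) prP coF nF1.
have idFf := is_ideal_adjoin f idF.
pose E := saturation P (adjoin F f).
have coE : coprimary P E by apply: saturation_coprimary coF idFf _ => //; apply: sub_adjoin.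
have FE : F `<=` E by move=> x Fx; apply: sub_saturation => //; apply: sub_adjoin.
have satU s t : ~ P s -> tensor_sum F G (eL s * t) -> tensor_sum F G t.
  move=> nPs /(tensor_sum_colon idF idG); apply: tensor_sum_mono => // x /=.
  by rewrite mulrC; apply: satF.
have [Eh|nEh] := pselect (tensor_sum E G h); last first.
  have Ff : F f.
    apply: (maxF E) => //; last by apply: sub_saturation => //; apply: mem_adjoin.
    split=> //; exists h => // r nPr rP; apply: (noR r nPr) => t Ft; apply: rP.
    exact: tensor_sum_mono Ft.
  by apply: (prime_not1 prP); rewrite PE /= mul1r.
(* one s outside P serves all the finitely many nonzero coordinates of h *)
have [c slc] := slicing_ex idG.
have /choice [u uP] (m : 'X_{1..p}) : exists s, ~ P s /\ adjoin F f (s * c m h).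
  by have [s ? ?] := slice_of_tensor_sum idG slc m coE.(coprimary_ideal) Eh; exists s.
have [N [cN _]] := slice_decomposition idG slc h.
pose s := \prod_(m : 'X_{1..p < N}) u m.
have nPs : ~ P s by apply: prime_prodN => // m _; apply: (uP m).1.
have sh : tensor_sum (adjoin F f) G (eL s * h).
  apply: (mem_tensor_sum idG slc) => m; rewrite (slice_mulL slc).
  have [/cN ->|mN] := leqP N (mdeg m); first by rewrite mulr0; apply: ideal0.
  rewrite /s (bigD1 (BMultinom mN)) //= mulrAC; apply: idealMr => //.
  exact: (uP (BMultinom mN)).2.
have [r rP] : exists r, tensor_sum F G (eL s * h - eL f * r).
  move: sh; move: (eL s * h); apply: tensor_ideal_ind => [|x y [r Fr] [r' Fr']|a b x].
  - by exists 0; rewrite mulr0 subr0; apply: ideal0; apply: is_ideal_tensor_sum.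
  - exists (r + r'); rewrite mulrDr opprD addrACA.
    by apply: idealD => //; apply: is_ideal_tensor_sum.
  case=> [[g [d Fd] <-]|[g Gg <-]]; last first.
    by exists 0; rewrite mulr0 subr0; apply: tensor_sumR.
  exists (eL a * eR b * eL d); rewrite (_ : _ - _ = eL (g - d * f) * (eL a * eR b)).
    exact: tensor_sumL.
  by rewrite rmorphB rmorphM; ring.
have nPr : ~ tensor_sum P G r.
  move=> /(tensor_sum_ass_colon _ idF idG PE).2 Ffr; apply: nFh; apply: (satU s) => //.
  exact: (idealBr (is_ideal_tensor_sum F G) rP).
apply: (noR r nPr) => t Ft; apply/(tensor_sum_ass_colon _ idF idG PE).
rewrite mulrCA (_ : t * (eL f * r) = eL s * (t * h) - t * (eL s * h - eL f * r)); last by ring.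
apply: idealB; first exact: is_ideal_tensor_sum.
  by apply: idealMl => //; apply: is_ideal_tensor_sum.
by apply: idealMl => //; apply: is_ideal_tensor_sum.
Qed.

Definition tensor_prod F G : set T := ideal_gen [set x | exists f g, [/\ F f, G g & x = eL f * eR g]].

Lemma mem_tensor_prod F G f g : F f -> G g -> tensor_prod F G (eL f * eR g).
Proof. by move=> Ff Gg; apply: sub_ideal_gen; exists f, g. Qed.

(** With F' in F and G' in G, F'G + FG' contains the intersection of FG with
    F' + G': modulo it, an element of FG agrees with its image under the product
    of the two normal form projectors, which kills F' + G'. *)
Lemma tensor_prod_cap_sum F F' G G' K x : is_ideal F -> is_ideal F' -> is_ideal G -> is_ideal G' ->
  F' `<=` F -> G' `<=` G -> is_ideal K ->
  (forall f g, F' f -> G g -> K (eL f * eR g)) ->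
  (forall f g, F f -> G' g -> K (eL f * eR g)) ->
  tensor_prod F G x -> tensor_sum F' G' x -> K x.
Proof.
move=> idF idF' idG idG' FF GG idK KF KG.
have [|||L [LD LM]] := tensor_lift tensT (b := fun f g => eL (normal_form F' f) * eR (normal_form G' g)).
- by move=> f f' g; rewrite normal_formD // rmorphD mulrDl.
- by move=> f g g'; rewrite normal_formD // rmorphD mulrDr.
- by move=> c f g; rewrite !normal_formZ // tensor_balanced.
have L0 : L 0 = 0 by apply: (addIr (L 0)); rewrite -LD !add0r.
move=> FGx F'x; have -> : x = x - L x.
  suff -> : L x = 0 by rewrite subr0.
  move: x F'x {FGx}; apply: tensor_ideal_ind => //= [x y Lx Ly|a b x].
    by rewrite LD Lx Ly addr0.
  case=> [[f Ff <-]|[g Gg <-]].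
    rewrite mulrAC -rmorphM LM (normal_form0P idF' _).2 ?rmorph0 ?mul0r //; exact: idealMl.
  rewrite -mulrA -rmorphM LM (normal_form0P idG' _).2 ?rmorph0 ?mulr0 //; exact: idealMl.
move: x FGx {F'x}; apply: tensor_ideal_ind => /= [|x y Kx Ky|a b _ [f [g [Ff Gg ->]]]].
- by rewrite L0 subr0; apply: ideal0.
- by rewrite LD opprD addrACA; apply: idealD.
rewrite mulrACA -!rmorphM LM; set f1 := a * f; set g1 := b * g.
have Ff1 : F f1 by apply: idealMl.
have Gg1 : G g1 by apply: idealMl.
rewrite (_ : _ - _ = eL (f1 - normal_form F' f1) * eR g1 + eL (normal_form F' f1) * eR (g1 - normal_form G' g1)).
  apply: idealD => //; first by apply: KF => //; apply: normal_form_sub.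
  apply: KG; last exact: normal_form_sub.
  rewrite (_ : normal_form F' f1 = f1 - (f1 - normal_form F' f1)); last by ring.
  by apply: idealB => //; apply: FF; apply: normal_form_sub.
by rewrite !rmorphB; ring.
Qed.

(** The N-th term of the product of two filtrations, as in the binomial formula. *)
Definition filtration_product (F : nat -> set A) (G : nat -> set B) (N : nat) : set T :=
  ideal_gen [set x | exists i j f g, [/\ (i + j)%N = N, F i f, G j g & x = eL f * eR g]].

Section Filtrations.
Variables (F : nat -> set A) (G : nat -> set B).
Hypotheses (idF : forall i, is_ideal (F i)) (idG : forall j, is_ideal (G j)).
Hypotheses (F0 : F 0%N 1) (G0 : G 0%N 1).
Hypotheses (FS : forall i, F i.+1 `<=` F i) (GS : forall j, G j.+1 `<=` G j).

Lemma filtration_product_sum N h : filtration_product F G N h ->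
  exists2 x : nat -> T, h = \sum_(i < N.+1) x i &
    forall i, (i <= N)%N -> tensor_prod (F i) (G (N - i)%N) (x i).
Proof.
move: h; apply: tensor_ideal_ind => [|x y [u -> uP] [v -> vP]|a b _ [i [j [f [g [<- Ff Gg ->]]]]]].
- exists (fun=> 0) => [|i _]; first by rewrite big1.
  by apply: ideal0; apply: is_ideal_gen.
- exists (fun i => u i + v i) => [|i le]; first by rewrite big_split.
  by apply: idealD; [apply: is_ideal_gen|apply: uP|apply: vP].
exists (fun l => if l == i then eL a * eR b * (eL f * eR g) else 0) => [|l le].
  have iN : (i < (i + j).+1)%N by rewrite ltnS leq_addr.
  rewrite (bigD1 (Ordinal iN)) //= eqxx big1 ?addr0 // => l.
  by rewrite -val_eqE /= => /negPf ->.
case: eqP => [->|_]; last by apply: ideal0; apply: is_ideal_gen.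
by rewrite addKn; apply: idealMl; [apply: is_ideal_gen|apply: mem_tensor_prod].
Qed.

(** The product filtration is an intersection of sums. By induction h is a sum
    of x_i in F_i G_(N-i); as the other x_j lie in F_(i+1) + G_(N-i+1), so does
    x_i, and the modular law moves x_i one step deeper. *)
Lemma filtration_product_of_tensor_sum N h :
  (forall i j, (i + j)%N = N.+1 -> tensor_sum (F i) (G j) h) -> filtration_product F G N h.
Proof.
elim: N h => [|N IHN] h hP.
  apply: ideal_all; first exact: is_ideal_gen.
  by apply: sub_ideal_gen; exists 0%N, 0%N, 1, 1; rewrite !rmorph1 mulr1.
have [|x hE xP] := @filtration_product_sum N h.
  apply: IHN => -[|i] [|j] // ij.
  - rewrite -(mul1r h) -(rmorph1 eL); exact: tensor_sumL.
  - rewrite -(mulr1 h) -(rmorph1 eR); exact: tensor_sumR.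
  - by move: (hP i.+1 j.+2); rewrite addnS ij => /(_ erefl); apply: tensor_sum_mono.
rewrite hE; apply: ideal_sum_in; first exact: is_ideal_gen.
move=> i _; have iN : (i <= N)%N by rewrite -ltnS.
apply: (tensor_prod_cap_sum (idF i) (idF i.+1) (idG (N - i)) (idG (N - i).+1)) (xP i iN) _ => //.
- exact: is_ideal_gen.
- move=> f g Ff Gg; apply: sub_ideal_gen; exists i.+1, (N - i)%N, f, g.
  by rewrite addSn subnKC.
- move=> f g Ff Gg; apply: sub_ideal_gen; exists i, (N - i).+1, f, g.
  by rewrite addnS subnKC.
have Fdec (a b : nat) : (a <= b)%N -> F b `<=` F a.
  by move=> /subnKC <-; elim: (b - a)%N => [|d IHd]; [rewrite addn0|rewrite addnS => y /FS /IHd].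
have Gdec (a b : nat) : (a <= b)%N -> G b `<=` G a.
  by move=> /subnKC <-; elim: (b - a)%N => [|d IHd]; [rewrite addn0|rewrite addnS => y /GS /IHd].
have -> : x i = h - \sum_(j < N.+1 | j != i) x j.
  by rewrite hE (bigD1 i) //= addrK.
apply: idealB; first exact: is_ideal_tensor_sum.
  by apply: hP; rewrite addSn addnS subnKC.
apply: ideal_sum_in => [|j ji]; first exact: is_ideal_tensor_sum.
have jN : (j <= N)%N by rewrite -ltnS.
move: (x j) (xP j jN); apply: ideal_gen_min; first exact: is_ideal_tensor_sum.
move=> _ [f [g [Ff Gg ->]]]; move: ji; rewrite -val_eqE /= neq_ltn => /orP [lt|lt].
  by apply: tensor_sumR; apply: Gdec Gg; rewrite ltn_sub2l // (leq_trans lt).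
by apply: tensor_sumL; apply: Fdec Ff.
Qed.

End Filtrations.

Lemma tensor_sum_power_mul I J i j f g : ideal_power I i f -> ideal_power J j g ->
  ideal_power (tensor_sum I J) (i + j) (eL f * eR g).
Proof.
move=> If Jg; apply: ideal_power_mul.
  by apply: rmorph_ideal_power If => x Ix; apply: sub_ideal_gen; left; exists x.
by apply: rmorph_ideal_power Jg => x Jx; apply: sub_ideal_gen; right; exists x.
Qed.

Lemma tensor_sum_power_sub I J N i j : (i + j)%N = N.+1 ->
  ideal_power (tensor_sum I J) N `<=` tensor_sum (ideal_power I i) (ideal_power J j).
Proof.
have trivL M' x : tensor_sum (ideal_power I 0) M' x.
  by rewrite -(mul1r x) -(rmorph1 eL); apply: tensor_sumL; apply: ideal_power0.
have trivR M x : tensor_sum M (ideal_power J 0) x.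
  by rewrite -(mulr1 x) -(rmorph1 eR); apply: tensor_sumR; apply: ideal_power0.
elim: N i j => [|N IHN] i j ij.
  case: i ij => [_ x _|i ij x _]; first exact: trivL.
  have -> : j = 0%N by lia.
  exact: trivR.
apply: ideal_powerS_min; first exact: is_ideal_tensor_sum.
move=> x y + Ny; move: x; apply: tensor_sum_min (is_ideal_colon y (is_ideal_tensor_sum _ _)) _ _ => /= f.
  case: i ij => [_|i]; last rewrite addSn => -[ij]; move=> If; first exact: trivL.
  apply: (tensor_sum_min (K := [set y | tensor_sum _ _ (eL f * y)])) (IHN i j ij y Ny).
  - by under eq_set do rewrite mulrC; apply: is_ideal_colon; apply: is_ideal_tensor_sum.
  - by move=> g Ig /=; rewrite -rmorphM -(mulr1 (eL _)); apply: tensor_sumL; apply: ideal_powerS_mul.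
  - by move=> g Jg /=; apply: tensor_sumR.
case: j ij => [_|j]; last rewrite addnS => -[ij]; move=> Jf; first exact: trivR.
apply: (tensor_sum_min (K := [set y | tensor_sum _ _ (eR f * y)])) (IHN i j ij y Ny).
- by under eq_set do rewrite mulrC; apply: is_ideal_colon; apply: is_ideal_tensor_sum.
- by move=> g Ig /=; rewrite mulrC; apply: tensor_sumL.
- by move=> g Jg /=; rewrite -rmorphM -(mul1r (eR _)); apply: tensor_sumR; apply: ideal_powerS_mul.
Qed.

End Tensor.

(** * The polynomial ring in both sets of variables as a tensor product *)

Section Embeddings.

Variables (k : fieldType) (n p : nat).
Local Notation A := {mpoly k[n]}.
Local Notation B := {mpoly k[p]}.
Local Notation T := {mpoly k[n + p]}.
Local Notation eL := (@embed_left k n p).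
Local Notation eR := (@embed_right k n p).

HB.instance Definition _ := GRing.RMorphism.copy eL
  (comp_mpoly [tuple 'X_(lshift p i) | i < n]).
HB.instance Definition _ := GRing.RMorphism.copy eR
  (comp_mpoly [tuple 'X_(rshift n i) | i < p]).

Let mleft (m : 'X_{1..n + p}) : 'X_{1..n} := [multinom m (lshift p i) | i < n].
Let mright (m : 'X_{1..n + p}) : 'X_{1..p} := [multinom m (rshift n i) | i < p].
Let mjoin (u : 'X_{1..n}) (v : 'X_{1..p}) : 'X_{1..n + p} :=
  [multinom match split i with inl j => u j | inr j => v j end | i < n + p].

Lemma mleft_join u v : mleft (mjoin u v) = u.
Proof. by apply/mnmP => i; rewrite !mnmE (unsplitK (inl i)). Qed.

Lemma mright_join u v : mright (mjoin u v) = v.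
Proof. by apply/mnmP => i; rewrite !mnmE (unsplitK (inr i)). Qed.

Lemma mjoinK m : mjoin (mleft m) (mright m) = m.
Proof.
apply/mnmP => i; rewrite mnmE.
by case: splitP => j ij; rewrite mnmE; congr (m _); apply: val_inj.
Qed.

Lemma embed_join u v : eL 'X_[u] * eR 'X_[v] = 'X_[mjoin u v].
Proof.
rewrite /embed_left /embed_right !comp_mpolyX [RHS]mpolyXE_id big_split_ord /=.
congr (_ * _); apply: eq_bigr => i _; rewrite tnth_mktuple mnmE.
  by rewrite (unsplitK (inl i)).
by rewrite (unsplitK (inr i)).
Qed.

Lemma mpoly_add_ind q (K : {mpoly k[q]} -> Prop) : K 0 ->
  (forall x y, K x -> K y -> K (x + y)) -> (forall c m, K (c *: 'X_[m])) -> forall t, K t.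
Proof. by move=> K0 KD KX t; rewrite [t]mpolyE; elim/big_ind: _. Qed.

Lemma embed_tensor : is_tensor eL eR.
Proof.
split=> [c|K KD KM t|V b bDl bDr bZ].
- by rewrite /embed_left /embed_right !comp_mpolyC.
- elim/mpoly_add_ind: t => [|//|c m].
    by have := KM 0 0; rewrite rmorph0 mul0r.
  by rewrite -(mjoinK m) -embed_join scalerAl -[c *: eL _]comp_mpolyZ; apply: KM.
have b0l g : b 0 g = 0 by apply: (addIr (b 0 g)); rewrite -bDl !add0r.
have b0r f : b f 0 = 0 by apply: (addIr (b f 0)); rewrite -bDr !add0r.
pose L t := \sum_(m <- msupp t) b (t@_m *: 'X_[mleft m]) 'X_[mright m].
have LE t s : uniq s -> {subset msupp t <= s} ->
    L t = \sum_(m <- s) b (t@_m *: 'X_[mleft m]) 'X_[mright m].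
  move=> us ts; rewrite [RHS](bigID (mem (msupp t))) /= [X in _ + X]big1 ?addr0.
    rewrite -big_filter; apply: perm_big; apply: uniq_perm; rewrite ?filter_uniq //.
    by move=> m; rewrite mem_filter; case: (boolP (m \in msupp t)) => // /ts ->.
  by move=> m; rewrite mcoeff_msupp negbK => /eqP ->; rewrite scale0r.
have LD x y : L (x + y) = L x + L y.
  pose s := undup (msupp x ++ msupp y).
  rewrite !(@LE _ s) ?undup_uniq //.
  - by rewrite -big_split; apply: eq_bigr => m _; rewrite mcoeffD scalerDl bDl.
  - by move=> m; rewrite mem_undup mem_cat => ->; rewrite orbT.
  - by move=> m; rewrite mem_undup mem_cat => ->.
  - by move=> m /msuppD_le; rewrite mem_undup.
have LX c m : L (c *: 'X_[m]) = b (c *: 'X_[mleft m]) 'X_[mright m].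
  rewrite (@LE _ [:: m]) //; first by rewrite big_seq1 mcoeffZ mcoeffX eqxx mulr1.
  by move=> u /msuppZ_le; rewrite msuppX.
have L0 : L 0 = 0 by rewrite /L msupp0 big_nil.
exists L; split=> // f g.
elim/mpoly_add_ind: f => [|x y xE yE|c u]; first by rewrite rmorph0 mul0r b0l.
  by rewrite rmorphD mulrDl LD xE yE bDl.
elim/mpoly_add_ind: g => [|x y xE yE|d v]; first by rewrite rmorph0 mulr0 b0r.
  by rewrite rmorphD mulrDr LD xE yE bDr.
rewrite [eL _]comp_mpolyZ [eR _]comp_mpolyZ -scalerAl -scalerAr embed_join scalerA LX mleft_join mright_join.
by rewrite -bZ scalerA mulrC.
Qed.

End Embeddings.

(** * The binomial formula for symbolic powers *)

Lemma tensor_sumC (k : fieldType) (n p : nat) (T : comNzRingType)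
    (eL : {rmorphism {mpoly k[n]} -> T}) (eR : {rmorphism {mpoly k[p]} -> T}) I J :
  tensor_sum eL eR I J = tensor_sum eR eL J I.
Proof. by rewrite /tensor_sum setUC. Qed.

Section SymbolicSum.

Variables (k : fieldType) (n p : nat).
Local Notation A := {mpoly k[n]}.
Local Notation B := {mpoly k[p]}.
Local Notation T := {mpoly k[n + p]}.
Local Notation eL := (@embed_left k n p).
Local Notation eR := (@embed_right k n p).
Variables (I : set A) (J : set B).
Hypotheses (idI : is_ideal I) (idJ : is_ideal J).

Let tensT : is_tensor eL eR := embed_tensor k n p.
Let tensT' : is_tensor eR eL := tensor_swap (embed_tensor k n p).

(** Locally at an associated prime of I + J, multiply by the denominators that
    f and g have at its contractions. *)
Lemma symbolic_sum_mul i j f g : symbolic_power I i f -> symbolic_power J j g ->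
  symbolic_power (ideal_sum I J) (i + j) (eL f * eR g).
Proof.
move=> /symbolic_powerP If /symbolic_powerP Jg; apply/symbolic_powerP => P aP.
have prP := ass_prime aP.
have [s nPs Is] := If _ (ass_contractL tensT idI idJ aP).
have [|t nPt Jt] := Jg [set b | P (eR b)].
  by apply: (ass_contractL tensT' idJ idI); rewrite tensor_sumC.
exists (eL s * eR t); first exact: prime_mulN.
by rewrite mulrACA -!rmorphM; apply: (tensor_sum_power_mul eL eR Is Jt).
Qed.

Lemma symbolic_powerE q (K : set {mpoly k[q]}) i : is_ideal K ->
  symbolic_power K i = \bigcap_(E in [set E | exists P, 
     [/\ Ass K P, coprimary P E & ideal_power K i `<=` E]]) E.
Proof.
move=> idK; apply/seteqP; split=> f.
  by move=> Kf E [P [aP cE KE]]; apply: (symbolic_power_coprimary aP cE KE Kf).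
move=> fE; apply: contrapT.
move=> /(symbolic_power_separation (@mpoly_noetherian k q) idK) [P [E [aP cE KE nEf]]].
by apply: nEf; apply: fE; exists P.
Qed.

(** If h were not in the product filtration, it would avoid some E + F with E and
    F primary at associated primes P and Q. Two reductions and the equality
    P + Q = (I + J : u v) then lead from h to an element whose annihilator
    modulo I + J contains (E + F : h); an associated prime above that annihilator
    admits no denominator for h. *)
Lemma symbolic_sum_sub N h : symbolic_power (ideal_sum I J) N h ->
  filtration_product eL eR (symbolic_power I) (symbolic_power J) N h.
Proof.
move=> /symbolic_powerP Nh.
apply: (filtration_product_of_tensor_sum tensT); try exact: is_ideal_symbolic_power.
- by apply: ideal_power_sub_symbolic; apply: ideal_power0.
- by apply: ideal_power_sub_symbolic; apply: ideal_power0.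
- by move=> i; apply: symbolic_powerW.
- by move=> i; apply: symbolic_powerW.
move=> i j ij; rewrite (symbolic_powerE _ idI).
apply: (tensor_sum_bigcap tensT) => [|E [P [_ []//]]|E [P [aP cE IE]]]; first exact: is_ideal_symbolic_power.
rewrite tensor_sumC (symbolic_powerE _ idJ).
apply: (tensor_sum_bigcap tensT') => [|F [Q [_ []//]]|F [Q [aQ cF JF]]]; first by case: cE.
rewrite tensor_sumC; apply: contrapT => nh.
have [r nr rP] := coprimary_colon_reduction tensT (ass_prime aP) cE (coprimary_ideal cF) nh.
move: nr; rewrite tensor_sumC => nr.
have [r' nr' r'P] := coprimary_colon_reduction tensT' (ass_prime aQ) cF (prime_ideal (ass_prime aP)) nr.
have [_ [u PE]] := aP; have [_ [v QE]] := aQ.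
have [|P0 aP0 P0P] := ass_above (@mpoly_noetherian k (n + p)) (is_ideal_tensor_sum eL eR I J)
  (x := eL u * (eR v * r')).
  move=> /(tensor_sum_ass_colon tensT _ idI idJ PE); rewrite tensor_sumC.
  by move=> /(tensor_sum_ass_colon tensT' _ idJ (prime_ideal (ass_prime aP)) QE).
have [s nPs Ns] := Nh P0 aP0; apply: nPs; apply: P0P => /=.
rewrite mulrCA; apply/(tensor_sum_ass_colon tensT _ idI idJ PE); rewrite tensor_sumC.
rewrite mulrCA; apply/(tensor_sum_ass_colon tensT' _ idJ (prime_ideal (ass_prime aP)) QE).
apply: r'P; rewrite tensor_sumC; apply: rP.
exact: (tensor_sum_mono IE JF (tensor_sum_power_sub ij Ns)).
Qed.

(** The power (I + J)^{s+t+1} lies in I^{s+1} + J^{t+1}, and modulo the latter f g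
    is a tensor product of two nonzero classes over a field. *)
Lemma ideal_sum_power_mulN s t f g : ~ ideal_power I s.+1 f -> ~ ideal_power J t.+1 g ->
  ~ ideal_power (ideal_sum I J) (s + t).+1 (eL f * eR g).
Proof.
move=> nIf nJg /(@tensor_sum_power_sub k n p T eL eR I J _ s.+1 t.+1).
rewrite addSn addnS => /(_ erefl).
by apply: (tensor_sum_mulN tensT) nIf nJg; apply: is_ideal_power.
Qed.

(** One of the generators f g in the binomial formula is outside the r-th power. *)
Lemma symbolic_sum_failure N r :
  ~ (symbolic_power (ideal_sum I J) N `<=` ideal_power (ideal_sum I J) r) ->
  exists i j f g, [/\ (i + j)%N = N, symbolic_power I i f, symbolic_power J j g &
    forall s t, ideal_power I s f -> ideal_power J t g -> (s + t < r)%N].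
Proof.
move=> nsub; apply: contrapT => noF; apply: nsub => h /symbolic_sum_sub.
move: h; apply: ideal_gen_min; first exact: is_ideal_power.
move=> _ [i [j [f [g [ij If Jg ->]]]]]; apply: contrapT => nr; apply: noF.
exists i, j, f, g; split=> // s t sf tg; rewrite ltnNge; apply/negP => le; apply: nr.
by apply: (ideal_powerW le); apply: (tensor_sum_power_mul eL eR sf tg).
Qed.

End SymbolicSum.

(** * The resurgence of a sum *)

Section Resurgence.

Variable R : realType.

Section General.
Variable A : idomainType.
Implicit Types (I : set A) (c : R).

Lemma resurgence_le I c : (resurgence R I <= c%:E)%E <->
  forall m r, (1 <= m)%N -> (1 <= r)%N -> 
    ~ (symbolic_power I m `<=` ideal_power I r) -> m%:R <= c * r%:R.
Proof.
split=> [Ic m r m1 r1 nsub|Ic].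
  have : ((m%:R / r%:R : R)%:E <= c%:E)%E.
    by apply: le_trans Ic; apply: ereal_sup_ubound; exists m, r.
  by rewrite lee_fin ler_pdivrMr // ltr0n.
apply: ge_ereal_sup => _ [m [r [m1 r1 nsub ->]]].
by rewrite lee_fin ler_pdivrMr ?ltr0n //; apply: Ic.
Qed.

Lemma resurgence_ge I m r : (1 <= m)%N -> (1 <= r)%N ->
  ~ (symbolic_power I m `<=` ideal_power I r) -> ((m%:R / r%:R)%:E <= resurgence R I)%E.
Proof. by move=> m1 r1 nsub; apply: ereal_sup_ubound; exists m, r. Qed.

Lemma resurgence_bound I a i s f : resurgence R I = a%:E -> (1 <= i)%N ->
  symbolic_power I i f -> ~ ideal_power I s.+1 f -> i%:R <= a * s.+1%:R.
Proof.
move=> Ia i1 If nIf; have : (resurgence R I <= a%:E)%E by rewrite Ia.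
by move=> /resurgence_le; apply=> // sub; apply: nIf; apply: sub.
Qed.

Lemma ideal_power_order I r f : ~ ideal_power I r f ->
  exists s, [/\ (s < r)%N, ideal_power I s f & ~ ideal_power I s.+1 f].
Proof.
elim: r => [|r IHr] nIf; first by case: nIf; apply: ideal_power0.
have [Ir|/IHr [s [sr sf nsf]]] := pselect (ideal_power I r f); first by exists r.
by exists s; split=> //; apply: leqW.
Qed.

Lemma symbolic_power_pred I i : resurgence R I = 1%:E ->
  symbolic_power I i `<=` ideal_power I i.-1.
Proof.
move=> I1 f If; case: i If => [|[|i]] If; try exact: ideal_power0.
apply: contrapT => nIf; have := resurgence_bound (i := i.+2) (s := i) I1 isT If nIf.
by rewrite mul1r ler_nat ltnn.
Qed.

Definition first_failure I i :=
  (forall j, (j < i)%N -> symbolic_power I j `<=` ideal_power I j) /\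
  ~ (symbolic_power I i `<=` ideal_power I i).

Lemma first_failure_dichotomy I : 
  (forall i, symbolic_power I i `<=` ideal_power I i) \/ exists i, first_failure I i.
Proof.
have [all_sub|/existsNP [i ni]] := pselect (forall i, symbolic_power I i `<=` ideal_power I i);
  [by left|right].
have [] := @ex_minnP [pred i | `[< ~ (symbolic_power I i `<=` ideal_power I i) >]].
  by exists i; apply/asboolP.
move=> m /asboolP nm minm; exists m; split=> // j jm; apply: contrapT => nj.
by have := minm j; rewrite leqNgt jm => /(_ (introT (asboolP _) nj)).
Qed.

Lemma first_failure_ge2 I i : noetherian A -> is_ideal I -> first_failure I i -> (2 <= i)%N.
Proof.
move=> noeth idI [_]; case: i => [|[|//]] [] f If; first exact: ideal_power0.
by rewrite ideal_power1 //; apply: symbolic_power1 If.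
Qed.

End General.

Section Sum.
Variables (k : fieldType) (n p : nat) (I : set {mpoly k[n]}) (J : set {mpoly k[p]}).
Hypotheses (idI : is_ideal I) (idJ : is_ideal J) (nI1 : ~ I 1) (nJ1 : ~ J 1).

Lemma resurgence_sum_ge : (resurgence R I <= resurgence R (ideal_sum I J))%E /\
  (resurgence R J <= resurgence R (ideal_sum I J))%E.
Proof.
split; apply: ge_ereal_sup => _ [m [[//|r] [m1 r1 /existsNP [f /not_implyP [mf rf]] ->]]];
  apply: resurgence_ge => // sub.
- have n1 : ~ ideal_power J 1 1 by rewrite ideal_power1.
  apply: (ideal_sum_power_mulN rf n1); rewrite addn0; apply: sub.
  rewrite -[m]addn0; apply: symbolic_sum_mul => //.
  by apply: ideal_power_sub_symbolic; apply: ideal_power0.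
- have n1 : ~ ideal_power I 1 1 by rewrite ideal_power1.
  apply: (ideal_sum_power_mulN n1 rf); rewrite add0n; apply: sub.
  rewrite -[m]add0n; apply: symbolic_sum_mul => //.
  by apply: ideal_power_sub_symbolic; apply: ideal_power0.
Qed.

(** With s, t >= 1, the bound a (s+1) + b (t+1) <= c (s+t+1) follows from its
    case s = t = 1, which is the last hypothesis, and from a, b <= c. *)
Lemma resurgence_sum_le a b c : resurgence R I = a%:E -> resurgence R J = b%:E ->
  a <= c -> b <= c -> 2 * (a + b) <= 3 * c -> (resurgence R (ideal_sum I J) <= c%:E)%E.
Proof.
move=> Ia Jb ac bc abc; apply/resurgence_le => N r N1 r1.
move=> /(symbolic_sum_failure idI idJ) [i [j [f [g [ij fi gj rP]]]]].
have nfr : ~ ideal_power I r f.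
  by move=> /rP /(_ (ideal_power0 J g)); rewrite addn0 ltnn.
have ngr : ~ ideal_power J r g.
  by move=> /(rP _ _ (ideal_power0 I f)); rewrite ltnn.
have [s [sr fs nfs]] := ideal_power_order nfr.
have [t [tr gt ngt]] := ideal_power_order ngr.
have str := rP _ _ fs gt.
have [i0|i1] := posnP i.
  have jN : j = N by rewrite -ij i0.
  have := resurgence_bound Jb _ gj ngt; rewrite jN => /(_ N1) NB.
  have b0 : 0 <= b.
    by have := le_trans (ler0n R N) NB; rewrite pmulr_lge0 // ltr0n.
  apply: le_trans NB _; apply: ler_pM => //; by rewrite ler_nat.
have [j0|j1] := posnP j.
  have iN : i = N by rewrite -ij j0 addn0.
  have := resurgence_bound Ia _ fi nfs; rewrite iN => /(_ N1) NB.
  have a0 : 0 <= a.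
    by have := le_trans (ler0n R N) NB; rewrite pmulr_lge0 // ltr0n.
  apply: le_trans NB _; apply: ler_pM => //; by rewrite ler_nat.
have s1 : (1 <= s)%N.
  rewrite lt0n; apply/eqP => s0; apply: nfs; rewrite s0 ideal_power1 //.
  by apply: (symbolic_power1 (@mpoly_noetherian k n)) => //; apply: symbolic_powerW fi.
have t1 : (1 <= t)%N.
  rewrite lt0n; apply/eqP => t0; apply: ngt; rewrite t0 ideal_power1 //.
  by apply: (symbolic_power1 (@mpoly_noetherian k p)) => //; apply: symbolic_powerW gj.
have iB := resurgence_bound Ia i1 fi nfs; have jB := resurgence_bound Jb j1 gj ngt.
rewrite -ij natrD.
have c0 : 0 <= c.
  apply: le_trans ac; have := le_trans (ler0n R i) iB; by rewrite pmulr_lge0 // ltr0n.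
have rB : s%:R + t%:R + 1 <= r%:R :> R by rewrite -natrD natr1 ler_nat.
move: s1 t1; rewrite -!(ler1n R) => s1 t1.
move: iB jB; rewrite -!(natr1 s) -!(natr1 t) => iB jB.
by nra.
Qed.

Hypotheses (resI : resurgence R I = 1%:E) (resJ : resurgence R J = 1%:E).

Lemma resurgence_sum_no_failure :
  (forall i, symbolic_power I i `<=` ideal_power I i) \/
  (forall j, symbolic_power J j `<=` ideal_power J j) ->
  resurgence R (ideal_sum I J) = 1%:E.
Proof.
move=> noF; apply/eqP; rewrite eq_le -{2}resI resurgence_sum_ge.1 andbT.
apply/resurgence_le => N r N1 r1.
move=> /(symbolic_sum_failure idI idJ) [i [j [f [g [ij fi gj rP]]]]].
rewrite mul1r ler_nat; case: noF => [/(_ _ _ fi) si|/(_ _ _ gj) sj].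
  by have := rP _ _ si (symbolic_power_pred resJ gj); lia.
by have := rP _ _ (symbolic_power_pred resI fi) sj; lia.
Qed.

(** The product of elements showing the two first failures gives the lower bound.
    For the upper bound, f g has order at least N - 1 unless i >= i0 and j >= j0,
    and order at least N - 2 always; in the exceptional case N >= i0 + j0. *)
Lemma resurgence_sum_first_failure i0 j0 : first_failure I i0 -> first_failure J j0 ->
  resurgence R (ideal_sum I J) = ((i0 + j0)%:R / (i0 + j0).-1%:R)%:E.
Proof.
move=> Fi Fj.
have i2 := first_failure_ge2 (@mpoly_noetherian k n) idI Fi.
have j2 := first_failure_ge2 (@mpoly_noetherian k p) idJ Fj.
case: Fi Fj => [subI /existsNP [f /not_implyP [fi nfi]]].
case=> [subJ /existsNP [g /not_implyP [gj ngj]]].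
apply/eqP; rewrite eq_le; apply/andP; split.
  apply/resurgence_le => N r N1 r1.
  move=> /(symbolic_sum_failure idI idJ) [i [j [f' [g' [ij fi' gj' rP]]]]].
  rewrite mulrAC ler_pdivlMr ?ltr0n; last by lia.
  rewrite -!natrM ler_nat.
  have rP' := rP _ _ (symbolic_power_pred resI fi') (symbolic_power_pred resJ gj').
  have [/subI/(_ _ fi') si|ii0] := ltnP i i0.
    by have := rP _ _ si (symbolic_power_pred resJ gj'); nia.
  have [/subJ/(_ _ gj') sj|jj0] := ltnP j j0.
    by have := rP _ _ (symbolic_power_pred resI fi') sj; nia.
  by nia.
apply: resurgence_ge; try by lia.
case: i0 i2 fi nfi {subI} => [//|s] i2 fi nfi; case: j0 j2 gj ngj {subJ} => [//|t] j2 gj ngj.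
move=> sub; apply: (ideal_sum_power_mulN nfi ngj); rewrite -(addnS s t) -[X in ideal_power _ X]/(s.+1 + t.+1).-1.
by apply: sub; apply: symbolic_sum_mul.
Qed.

End Sum.

End Resurgence.

(** * The weight filtration of k[x, y, t] *)

Section PolyOrder.
Variable S : idomainType.
Implicit Types (p q : {poly S}).

Lemma low_coef_factor p N : (forall i, (i < N)%N -> p`_i = 0) -> p = drop_poly N p * 'X^N.
Proof.
move=> p0; rewrite -[LHS](poly_take_drop N) (_ : take_poly N p = 0) ?add0r //.
by apply/polyP => i; rewrite coef_take_poly coef0; case: ltnP => // /p0.
Qed.

Lemma low_coefM p q M N : (forall i, (i < M)%N -> p`_i = 0) -> (forall i, (i < N)%N -> q`_i = 0) ->
  (forall i, (i < M + N)%N -> (p * q)`_i = 0) /\ (p * q)`_(M + N) = p`_M * q`_N.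
Proof.
move=> /low_coef_factor pE /low_coef_factor qE.
have {1 2}-> : p * q = drop_poly M p * drop_poly N q * 'X^(M + N).
  by rewrite {1}pE {1}qE exprD mulrACA.
split=> [i|]; first by rewrite coefMXn => ->.
by rewrite coefMXn ltnn subnn coef0M !coef_drop_poly !add0n.
Qed.

End PolyOrder.

Section Weights.

Variable k : fieldType.
Local Notation A := {mpoly k[3]}.
Local Notation x0 := (@Ordinal 3 0 isT).
Local Notation x1 := (@Ordinal 3 1 isT).
Local Notation x2 := (@Ordinal 3 2 isT).
Implicit Types (f g s : A) (m u : 'X_{1..3}).

(** The substitution x = T, y = Y T^2, t = t: the coefficient of T^N is the part
    of weight N, dehomogenised by x = 1 and seen as a polynomial in Y over k[t]. *)
Definition wexp_var (i : 'I_3) : {poly {poly {poly k}}} :=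
  nth 0 [:: 'X; 'X%:P * 'X^2; 'X%:P%:P] i.

Definition wexp : A -> {poly {poly {poly k}}} :=
  mmap (polyC \o (polyC \o polyC)) wexp_var.

HB.instance Definition _ := GRing.RMorphism.copy wexp
  (mmap (polyC \o (polyC \o polyC)) wexp_var).

Lemma wexpD f g : wexp (f + g) = wexp f + wexp g. Proof. exact: rmorphD. Qed.

Lemma wexpB f g : wexp (f - g) = wexp f - wexp g. Proof. exact: rmorphB. Qed.

Lemma wexpM f g : wexp (f * g) = wexp f * wexp g. Proof. exact: rmorphM. Qed.

Lemma wexpXn f n : wexp (f ^+ n) = wexp f ^+ n. Proof. exact: rmorphXn. Qed.

Definition weight m : nat := (m x0 + 2 * m x1)%N.

Lemma wexp_var0 : wexp 'X_x0 = 'X.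
Proof. by rewrite /wexp mmapX mmap1U. Qed.

Lemma wexp_var1 : wexp 'X_x1 = 'X%:P * 'X^2.
Proof. by rewrite /wexp mmapX mmap1U. Qed.

Lemma wexp_var2 : wexp 'X_x2 = 'X%:P%:P.
Proof. by rewrite /wexp mmapX mmap1U. Qed.

Lemma mnm3E m : 'X_[m] = 'X_x0 ^+ m x0 * 'X_x1 ^+ m x1 * 'X_x2 ^+ m x2 :> A.
Proof.
rewrite mpolyXE_id !big_ord_recl big_ord0 mulr1 mulrA.
by congr (_ ^+ _ * _ ^+ _ * _ ^+ _); congr (_ _); apply: val_inj.
Qed.

Lemma wexpX m : wexp 'X_[m] = (('X ^+ m x2)%:P * 'X ^+ m x1)%:P * 'X^(weight m).
Proof.
rewrite mnm3E !rmorphM !rmorphXn /= wexp_var0 wexp_var1 wexp_var2.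
by rewrite exprMn -exprM /weight exprD; ring.
Qed.

Lemma wexpC (c : k) : wexp c%:MP = c%:P%:P%:P.
Proof. by rewrite /wexp mmapC. Qed.

Lemma wexpZ c f : wexp (c *: f) = c%:P%:P%:P * wexp f.
Proof. by rewrite -mul_mpolyC rmorphM /= wexpC. Qed.

Lemma wexpX_coef m N b c : (wexp 'X_[m])`_N`_b`_c = 
  ([&& N == weight m, b == m x1 & c == m x2])%:R.
Proof.
rewrite wexpX coefCM coefXn; case: (N == weight m); last by rewrite mulr0 !coef0.
rewrite mulr1 coefCM coefXn; case: (b == m x1); last by rewrite mulr0 !coef0.
by rewrite mulr1 coefXn.
Qed.

(** No coefficient is lost: T^N Y^b t^c determines the exponents of x, y and t. *)
Lemma wexp_coef f m : (wexp f)`_(weight m)`_(m x1)`_(m x2) = f@_m.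
Proof.
elim/mpoly_add_ind: f => [|f g fE gE|c u]; first by rewrite rmorph0 !coef0 mcoeff0.
  by rewrite wexpD !coefD fE gE mcoeffD.
rewrite wexpZ !coefCM wexpX_coef mcoeffZ mcoeffX; congr (_ * (nat_of_bool _)%:R).
apply/and3P/eqP => [[/eqP wE /eqP bE /eqP cE]|-> //].
apply/mnmP => -[[|[|[|//]]] i3]; rewrite (bool_irrelevance i3 isT) //.
by move: wE; rewrite /weight bE; lia.
Qed.

Lemma wexp_coef_big f N b : (N < 2 * b)%N -> (wexp f)`_N`_b = 0.
Proof.
move=> Nb; elim/mpoly_add_ind: f => [|f g fE gE|c u]; first by rewrite rmorph0 !coef0.
  by rewrite wexpD !coefD fE gE addr0.
rewrite wexpZ !coefCM; apply/polyP => d; rewrite coefCM wexpX_coef coef0.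
case: eqP => [NE|]; last by rewrite mulr0.
case: eqP => [bE|]; last by rewrite mulr0.
by move: Nb; rewrite NE bE /weight; lia.
Qed.

Lemma wexp_coef0 f : (wexp f)`_0 = ((wexp f)`_0`_0)%:P.
Proof. by apply/polyP => -[|b]; rewrite coefC //= wexp_coef_big. Qed.

Definition weight_ideal (N : nat) : set A := [set f | forall i, (i < N)%N -> (wexp f)`_i = 0].

Local Notation O := weight_ideal.

Lemma weight_idealW M N : (M <= N)%N -> O N `<=` O M.
Proof. by move=> MN f Of i iM; apply: Of; apply: leq_trans MN. Qed.

Lemma weight_ideal0 f : O 0 f. Proof. by []. Qed.

Lemma weight_idealM M N f g : O M f -> O N g -> O (M + N) (f * g) /\
  (wexp (f * g))`_(M + N) = (wexp f)`_M * (wexp g)`_N.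
Proof. by move=> Of Og; rewrite /O /= rmorphM; apply: low_coefM. Qed.

Lemma is_ideal_weight N : is_ideal (O N).
Proof.
split=> [i _|f g Of Og i iN|a f Of]; first by rewrite rmorph0 coef0.
  by rewrite wexpD coefD (Of i iN) (Og i iN) addr0.
by rewrite -[N]add0n; apply: (weight_idealM _ Of).1.
Qed.

Lemma weight_idealX m N : (N <= weight m)%N -> O N 'X_[m].
Proof.
move=> Nm i iN; rewrite wexpX coefCM coefXn.
by rewrite ltn_eqF ?mulr0 // (leq_trans iN).
Qed.

Lemma weight_ideal_supp N f m : O N f -> m \in msupp f -> (N <= weight m)%N.
Proof.
move=> Of; rewrite mcoeff_msupp leqNgt; apply: contraNN => mN.
by rewrite -wexp_coef Of // !coef0.
Qed.

Lemma weight_ideal_min N (K : set A) : is_ideal K -> 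
  (forall m, (N <= weight m)%N -> K 'X_[m]) -> O N `<=` K.
Proof.
move=> idK KX f Of; rewrite [f]mpolyE big_seq; apply: ideal_sum_in => // m mf.
by apply: idealZ => //; apply: KX; apply: weight_ideal_supp mf.
Qed.

Lemma weight_idealS N f : O N f -> (wexp f)`_N = 0 -> O N.+1 f.
Proof.
by move=> Of fN i; rewrite ltnS leq_eqVlt => /predU1P [->//|]; apply: Of.
Qed.

Lemma not_weight1 s : ~ O 1 s -> (wexp s)`_0 != 0.
Proof. by move=> nOs; apply/eqP => s0; apply: nOs; case. Qed.

Lemma weight_prime : is_prime_ideal (O 1).
Proof.
split; [exact: is_ideal_weight|by move=> /(_ 0%N isT) /eqP; rewrite rmorph1 coef1 oner_eq0|].
move=> f g Ofg; have [|nOf] := pselect (O 1 f); first by left.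
right; case=> // _; have := Ofg 0%N isT; rewrite wexpM coef0M => /eqP.
by rewrite mulf_eq0 (negPf (not_weight1 nOf)) /= => /eqP.
Qed.

(** The weight of a product is the sum of the weights, and outside the first
    weight ideal the weight is 0. *)
Lemma weight_saturated N : saturated (O 1) (O N).
Proof.
move=> s f ns; elim: N => [_|N IHN Osf]; first exact: weight_ideal0.
have Of : O N f by apply: IHN; apply: weight_idealW Osf.
apply: weight_idealS => //; have := (weight_idealM (weight_ideal0 s) Of).2.
rewrite add0n (Osf N (ltnSn N)) => /esym /eqP; rewrite mulf_eq0 (negPf (not_weight1 ns)) /=.
by move/eqP.
Qed.

Lemma weight_power (I : set A) d n : I `<=` O d -> ideal_power I n `<=` O (n * d).
Proof.
move=> Id; elim: n => [|n IHn]; first by move=> f _; apply: weight_ideal0.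
apply: ideal_powerS_min; first exact: is_ideal_weight.
by move=> f g /Id Of /IHn Og; rewrite mulSn; apply: (weight_idealM Of Og).1.
Qed.

(** A monomial x^i y^j with i < 2D and j < D has weight at most 4D - 3, so from
    weight 4D on one of the two powers can be split off. *)
Lemma weight_sub_power (I : set A) D c n : is_ideal I -> (0 < n)%N ->
  I ('X_x0 ^+ (2 * D)) -> I ('X_x1 ^+ D) -> O (2 * D + c) `<=` I ->
  O (n * (2 * D) + c) `<=` ideal_power I n.
Proof.
move=> idI n0 Ix Iy Oc; apply: weight_ideal_min; first exact: is_ideal_power.
elim: n n0 => // -[_ _|n IHn _] m mw.
  by rewrite ideal_power1 //; apply: Oc; apply: weight_idealX; move: mw; rewrite mul1n.
have [m0|m0] := leqP (2 * D) (m x0).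
  have le : (U_(x0) *+ (2 * D) <= m)%MM.
    apply/mnm_lepP => i; rewrite mulmnE mnm1E.
    by case: eqP => [<-|_]; rewrite ?mul1n ?mul0n.
  rewrite -(submK le) mpolyXD mulrC; apply: ideal_powerS_mul; first by rewrite -mpolyXn.
  apply: (IHn isT); rewrite /weight !mnmBE !mulmnE !mnm1E /= mul1n mul0n.
  by move: mw; rewrite /weight; lia.
have [m1|m1] := leqP D (m x1).
  have le : (U_(x1) *+ D <= m)%MM.
    apply/mnm_lepP => i; rewrite mulmnE mnm1E.
    by case: eqP => [<-|_]; rewrite ?mul1n ?mul0n.
  rewrite -(submK le) mpolyXD mulrC; apply: ideal_powerS_mul; first by rewrite -mpolyXn.
  apply: (IHn isT); rewrite /weight !mnmBE !mulmnE !mnm1E /= mul1n mul0n.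
  by move: mw; rewrite /weight; lia.
by move: mw; rewrite /weight; nia.
Qed.

End Weights.

(** * Ideals of resurgence one whose symbolic powers differ late *)

(* keeps unification from unfolding the substitution *)
Opaque wexp.

Section Example.

Variable k : fieldType.
Variable q : nat.
Hypothesis q2 : (2 <= q)%N.
Local Notation A := {mpoly k[3]}.
Local Notation Q := {poly {poly k}}.
Local Notation x0 := (@Ordinal 3 0 isT).
Local Notation x1 := (@Ordinal 3 1 isT).
Local Notation x2 := (@Ordinal 3 2 isT).
Local Notation O := (@weight_ideal k).
Implicit Types (f g s : A) (m u : 'X_{1..3}) (F G : Q).

Variables (D kappa : nat).
Hypotheses (DE : D = (q * q + 2)%N) (kappaE : (kappa + q = q * q + 1)%N).

Lemma D_gt : (q < D)%N. Proof. by rewrite DE; nia. Qed.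
Lemma kappa_gt0 : (0 < kappa)%N. Proof. by move: kappaE; nia. Qed.

(** The part of weight 2D of the generator w; those of v, u and z are 1, Y and
    Y^D. *)
Definition w_part : Q := 'X^q + ('X^kappa)%:P * 'X^(D.-1).

(** The part of lowest weight of v^a u^i z^j w^l, for any a. *)
Definition product_part (l i j : nat) : Q := 'X^(i + D * j) * w_part ^+ l.

(** The lowest power of Y occurring in that part. *)
Definition low_exponent (l i j : nat) : nat := (q * l + i + D * j)%N.

Lemma product_part_factor l i j :
  product_part l i j = (1 + ('X^kappa)%:P * 'X^(D.-1 - q)) ^+ l * 'X^(low_exponent l i j).
Proof.
rewrite /product_part (_ : w_part = (1 + ('X^kappa)%:P * 'X^(D.-1 - q)) * 'X^q).
  by rewrite exprMn -exprM mulrCA -exprD /low_exponent; congr (_ * 'X^_); lia.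
rewrite mulrDl mul1r -mulrA -exprD subnK //.
by have := D_gt; case: D.
Qed.

Lemma product_part_low l i j b : (b < low_exponent l i j)%N -> (product_part l i j)`_b = 0.
Proof. by rewrite product_part_factor coefMXn => ->. Qed.

Lemma product_part_lead l i j : (product_part l i j)`_(low_exponent l i j) = 1.
Proof.
rewrite product_part_factor coefMXn ltnn subnn -horner_coef0 horner_exp hornerD hornerM hornerXn.
rewrite expr0n subn_eq0 (_ : (D.-1 <= q)%N = false) ?mulr0 ?addr0 ?hornerC ?expr1n //.
by apply/negbTE; rewrite -ltnNge DE; nia.
Qed.

Definition triple n := ('I_n.+1 * 'I_n.+1 * 'I_n.+1)%type.
Definition in_range n (t : triple n) := (t.1.1 + t.1.2 + t.2 <= n)%N.

(** The possible parts of weight 2Dn of an element of the n-th power. *)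
Definition leading_space n : set Q := [set G | exists c : triple n -> {poly k},
  G = \sum_(t | in_range t) (c t)%:P * product_part t.1.1 t.1.2 t.2].

Lemma leading_space0 n : leading_space n 0.
Proof. by exists (fun=> 0); rewrite big1 // => t _; rewrite mul0r. Qed.

Lemma leading_spaceD n F G : leading_space n F -> leading_space n G -> leading_space n (F + G).
Proof.
move=> [c ->] [d ->]; exists (fun t => c t + d t); rewrite -big_split.
by apply: eq_bigr => t _; rewrite polyCD mulrDl.
Qed.

Lemma leading_spaceZ n a G : leading_space n G -> leading_space n (a%:P * G).
Proof.
move=> [c ->]; exists (fun t => a * c t); rewrite mulr_sumr.
by apply: eq_bigr => t _; rewrite polyCM mulrA.
Qed.

Lemma leading_space_gen n l i j : (l + i + j <= n)%N -> leading_space n (product_part l i j).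
Proof.
move=> le; have ln : (l < n.+1)%N by lia.
have in' : (i < n.+1)%N by lia.
have jn : (j < n.+1)%N by lia.
exists (fun t => (t == (Ordinal ln, Ordinal in', Ordinal jn))%:R).
rewrite (bigD1 (Ordinal ln, Ordinal in', Ordinal jn)) //= eqxx mul1r big1 ?addr0 //.
by move=> t /andP [_ /negPf ->]; rewrite mul0r.
Qed.

Lemma leading_space_min n (K : set Q) : K 0 -> (forall F G, K F -> K G -> K (F + G)) ->
  (forall a G, K G -> K (a%:P * G)) ->
  (forall l i j, (l + i + j <= n)%N -> K (product_part l i j)) -> leading_space n `<=` K.
Proof.
move=> K0 KD KZ Kg _ [c ->]; elim/big_ind: _ => // t tP.
by apply: KZ; apply: Kg.
Qed.

Lemma product_partM l i j l' i' j' :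
  product_part l i j * product_part l' i' j' = product_part (l + l') (i + i') (j + j').
Proof.
rewrite /product_part (_ : i + i' + D * (j + j') = (i + D * j) + (i' + D * j'))%N; last by lia.
by rewrite [in RHS]exprD (exprD w_part) mulrACA.
Qed.

Lemma leading_spaceM (m n : nat) F G : leading_space m F -> leading_space n G -> leading_space (m + n) (F * G).
Proof.
move=> WF WG; move: F WF; apply: leading_space_min => [|F F' KF KF'|a F KF|l i j le].
- by rewrite mul0r; apply: leading_space0.
- by rewrite mulrDl; apply: leading_spaceD.
- by rewrite -mulrA; apply: leading_spaceZ.
move: G WG; apply: leading_space_min => /= [|F F' KF KF'|a F KF|l' i' j' le'].
- by rewrite mulr0; apply: leading_space0.
- by rewrite mulrDr; apply: leading_spaceD.
- by rewrite mulrCA; apply: leading_spaceZ.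
by rewrite product_partM; apply: leading_space_gen; lia.
Qed.

(** Below degree q the lowest exponents are the distinct numbers with digits
    j, l, i in mixed base D, q; the relation u^q = v^(q-1) w is the first
    coincidence. *)
Lemma low_exponent_inj n (t t' : triple n) : (n < q)%N -> in_range t -> in_range t' ->
  low_exponent t.1.1 t.1.2 t.2 = low_exponent t'.1.1 t'.1.2 t'.2 -> t = t'.
Proof.
case: t t' => -[l i] j [[l' i'] j']; rewrite /in_range /low_exponent /= => nq le le' eE.
have small (a b c : nat) : (a + b + c <= n)%N -> (q * a + b < D)%N by rewrite DE; nia.
have jj : (j : nat) = j'.
  have := congr1 (fun e => (e %/ D)%N) eE; rewrite ![(D * _)%N]mulnC.
  by rewrite !divnDMl ?(divn_small (small _ _ _ le)) ?(divn_small (small _ _ _ le')) // DE addn2.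
have eE' : (q * l + i = q * l' + i')%N by move: eE; rewrite jj => /addIn.
have ll : (l : nat) = l'.
  have := congr1 (fun e => (e %/ q)%N) eE'; rewrite ![(q * _)%N]mulnC.
  by rewrite !divnMDl ?divn_small ?addn0 //; lia.
have ii : (i : nat) = i' by move: eE'; rewrite ll => /addnI.
by congr (_, _, _); apply: val_inj.
Qed.

(** In a nontrivial combination, the smallest of the distinct lowest exponents
    survives with its coefficient. *)
Lemma leading_space_eq0 n G : (n < q)%N -> leading_space n G ->
  (forall l i j, (l + i + j <= n)%N -> G`_(low_exponent l i j) = 0) -> G = 0.
Proof.
move=> nq [c ->] G0; apply: big1 => t0 t0P.
suff c0 e : forall t, in_range t -> (low_exponent t.1.1 t.1.2 t.2 < e)%N -> c t = 0.
  by rewrite (c0 _ t0 t0P (ltnSn _)) mul0r.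
elim: e => [//|e IHe] t tP; rewrite ltnS leq_eqVlt => /predU1P [te|]; last exact: IHe.
have := G0 _ _ _ tP; rewrite coef_sum (bigD1 t) //= coefCM product_part_lead mulr1.
rewrite big1 ?addr0 // => t' /andP [t'P t't]; rewrite coefCM.
have [lt|gt|eq] := ltngtP (low_exponent t'.1.1 t'.1.2 t'.2) (low_exponent t.1.1 t.1.2 t.2).
- by rewrite IHe ?mul0r // -te.
- by rewrite product_part_low ?mulr0.
- by rewrite (low_exponent_inj nq t'P tP eq) eqxx in t't.
Qed.

(** At t = 0 the space is spanned by monomials, whose exponents ql + i + Dj with
    l + i + j <= q avoid D - 1 = q^2 + 1. *)
Lemma leading_space_special : ~ leading_space q ('X^(D.-1)).
Proof.
pose sp := map_poly (horner_eval (0 : k)).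
suff W0 : leading_space q `<=` [set G | (sp G)`_D.-1 = 0].
  by move=> /W0 /eqP /=; rewrite /sp map_polyXn coefXn eqxx oner_eq0.
apply: leading_space_min => /= [|F G F0 G0|a G G0|l i j le].
- by rewrite /sp rmorph0 coef0.
- by rewrite /sp rmorphD coefD -!/(sp _) F0 G0 addr0.
- by rewrite /sp rmorphM /= map_polyC coefCM -/(sp _) G0 mulr0.
rewrite /sp /product_part /w_part rmorphM !rmorphXn rmorphD rmorphM !rmorphXn /= !map_polyX map_polyC /=.
rewrite /horner_eval hornerX polyC0 expr0n (gtn_eqF kappa_gt0) mul0r addr0 -exprM -exprD coefXn.
case: eqP => // eD; exfalso; move: eD; rewrite DE; case: j le => [|j] le; nia.
Qed.

Definition late_v : A := 'X_x0 ^+ (2 * D).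
Definition late_u : A := 'X_x0 ^+ (2 * D - 2) * 'X_x1.
Definition late_z : A := 'X_x1 ^+ D.
Definition late_w : A :=
  'X_x0 ^+ (2 * D - 2 * q) * 'X_x1 ^+ q + 'X_x2 ^+ kappa * ('X_x0 ^+ 2 * 'X_x1 ^+ (D.-1)).

Definition late_gens : set A := [set f | [\/ f = late_v, f = late_u, f = late_z | f = late_w] \/
  exists2 m, (2 * D < weight m)%N & f = 'X_[m]].

Definition late_ideal : set A := ideal_gen late_gens.
Local Notation I := late_ideal.

Lemma is_ideal_late : is_ideal I. Proof. exact: is_ideal_gen. Qed.

Lemma wexp_xy a b : wexp ('X_x0 ^+ a * 'X_x1 ^+ b : A) = ('X^b)%:P * 'X^(a + 2 * b).
Proof.
rewrite rmorphM !rmorphXn /= wexp_var0 wexp_var1 exprMn -exprM exprD ?polyC_exp.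
by rewrite mulrCA mulrA.
Qed.

Lemma wexp_v : wexp late_v = 'X^(2 * D).
Proof. by rewrite -[late_v]mulr1 -(expr0 'X_x1) wexp_xy expr0 mul1r addn0. Qed.

Lemma wexp_u : wexp late_u = ('X)%:P * 'X^(2 * D).
Proof. by rewrite /late_u -(expr1 'X_x1) wexp_xy expr1; congr (_ * 'X^_); rewrite DE; lia. Qed.

Lemma wexp_z : wexp late_z = ('X^D)%:P * 'X^(2 * D).
Proof. by rewrite -[late_z]mul1r -(expr0 'X_x0) wexp_xy. Qed.

Lemma wexp_w : wexp late_w = w_part%:P * 'X^(2 * D).
Proof.
rewrite /late_w rmorphD /= [wexp ('X_x2 ^+ _ * _)]rmorphM /= !wexp_xy [wexp (_ ^+ _)]rmorphXn /= wexp_var2.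
rewrite (_ : 2 * D - 2 * q + 2 * q = 2 * D)%N; last by have := D_gt; lia.
rewrite (_ : 2 + 2 * D.-1 = 2 * D)%N; last by have := D_gt; lia.
by rewrite /w_part polyCD polyCM ?polyC_exp; ring.
Qed.

Definition late_monomial a l i j : A := late_v ^+ a * late_u ^+ i * late_z ^+ j * late_w ^+ l.

Lemma wexp_monomial a l i j :
  wexp (late_monomial a l i j) = (product_part l i j)%:P * 'X^((a + l + i + j) * (2 * D)).
Proof.
rewrite /late_monomial 3!wexpM 4!wexpXn.
rewrite wexp_v wexp_u wexp_z wexp_w !exprMn -!exprM.
rewrite /product_part polyCM polyC_exp exprD polyCM !polyC_exp -exprM.
rewrite (_ : (a + l + i + j) * (2 * D) = 2 * D * a + 2 * D * l + 2 * D * i + 2 * D * j)%N; last by lia.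
by rewrite !(exprD 'X); ring.
Qed.

Lemma late_gen_v : I late_v. Proof. by apply: sub_ideal_gen; left; constructor 1. Qed.
Lemma late_gen_u : I late_u. Proof. by apply: sub_ideal_gen; left; constructor 2. Qed.
Lemma late_gen_z : I late_z. Proof. by apply: sub_ideal_gen; left; constructor 3. Qed.
Lemma late_gen_w : I late_w. Proof. by apply: sub_ideal_gen; left; constructor 4. Qed.

Lemma weight_sub_late : O (2 * D).+1 `<=` I.
Proof.
apply: weight_ideal_min => [|m mD]; first exact: is_ideal_late.
by apply: sub_ideal_gen; right; exists m.
Qed.

Lemma weight_sub_late_power n : O (n * (2 * D)).+1 `<=` ideal_power I n.
Proof.
case: n => [|n]; first by move=> f _; apply: ideal_power0.
move=> f Of; apply: (weight_sub_power (D := D) (c := 1)); rewrite ?addn1 //.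
- exact: is_ideal_late.
- exact: late_gen_v.
- exact: late_gen_z.
- exact: weight_sub_late.
Qed.

Lemma late_monomial_power a l i j : ideal_power I (a + l + i + j) (late_monomial a l i j).
Proof.
rewrite (_ : a + l + i + j = a + i + j + l)%N; last by lia.
do 3 (apply: ideal_power_mul; last by apply: ideal_power_exp;
  (exact: late_gen_u || exact: late_gen_z || exact: late_gen_w)).
by apply: ideal_power_exp; apply: late_gen_v.
Qed.

Lemma lead_monomial G N f : wexp f = G%:P * 'X^N -> O N f /\ (wexp f)`_N = G.
Proof.
move=> fE; split=> [b bN|]; rewrite fE coefMXn; first by rewrite bN.
by rewrite ltnn subnn coefC.
Qed.

Lemma is_ideal_lead n N : is_ideal [set f : A | O N f /\ leading_space n (wexp f)`_N].
Proof.
split=> [|g h [Og Wg] [Oh Wh]|a g [Og Wg]].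
- by split; [apply: (ideal0 (is_ideal_weight k _))|rewrite rmorph0 coef0; apply: leading_space0].
- split; first exact: (idealD (is_ideal_weight k _) Og Oh).
  by rewrite rmorphD coefD; exact: leading_spaceD Wg Wh.
have := weight_idealM (weight_ideal0 a) Og; rewrite add0n => -[Oag E].
split; first exact: Oag.
by rewrite E [X in X * _]wexp_coef0; exact: leading_spaceZ Wg.
Qed.

Lemma late_lead f : I f -> O (2 * D) f /\ leading_space 1 (wexp f)`_(2 * D).
Proof.
apply: (ideal_gen_min (is_ideal_lead 1 (2 * D))).
have lead_in G h l i j : wexp h = G%:P * 'X^(2 * D) -> G = product_part l i j -> (l + i + j <= 1)%N ->
    O (2 * D) h /\ leading_space 1 (wexp h)`_(2 * D).
  by move=> /lead_monomial [Oh ->] ->; split=> //; apply: leading_space_gen.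
move=> g [[]->|[m mD ->]]; last first.
  have Om := weight_idealX k mD; split; first exact: weight_idealW Om.
  by rewrite Om //; apply: leading_space0.
- by apply: (lead_in _ _ 1%N 0%N 0%N wexp_w); rewrite // /product_part muln0 expr0 mul1r.
- by apply: (lead_in _ _ 0%N 0%N 1%N wexp_z); rewrite // /product_part muln1 expr0 mulr1.
- by apply: (lead_in _ _ 0%N 1%N 0%N wexp_u); rewrite // /product_part muln0 expr0 mulr1.
- have e : wexp late_v = 1%:P * 'X^(2 * D) by rewrite wexp_v mul1r.
  by apply: (lead_in _ _ 0%N 0%N 0%N e); rewrite // /product_part muln0 !expr0 mulr1.
Qed.

Lemma late_power_lead n f : ideal_power I n f ->
  O (n * (2 * D)) f /\ leading_space n (wexp f)`_(n * (2 * D)).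
Proof.
elim: n f => [|n IHn] f.
  move=> _; split=> //; rewrite mul0n wexp_coef0 -[_%:P]mulr1; apply: leading_spaceZ.
  by rewrite (_ : 1 = product_part 0 0 0); [apply: leading_space_gen|rewrite /product_part muln0 !expr0 mul1r].
move: f; apply: (ideal_powerS_min (is_ideal_lead n.+1 (n.+1 * (2 * D)))).
move=> x y /late_lead [Ox Wx] /IHn [Oy Wy] /=.
have [] := weight_idealM Ox Oy; rewrite -mulSn => Oxy ->; split=> //.
by rewrite -[n.+1]add1n; apply: leading_spaceM.
Qed.

Lemma lift_coef (c : {poly k}) : exists a : A, wexp a = c%:P%:P.
Proof.
elim/poly_ind: c => [|c d [a aE]]; first by exists 0; rewrite rmorph0.
exists (a * 'X_x2 + d%:MP); rewrite rmorphD rmorphM /= aE wexp_var2 wexpC.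
by rewrite !polyCD !polyCM.
Qed.

(** Division by the products of generators: their leading parts start with
    coefficient 1, so the exponents that they hit can be cleared in increasing
    order, without denominators from k[t]. *)
Lemma late_reduction n f N : O (n * (2 * D)) f ->
  exists g, [/\ ideal_power I n g, O (n * (2 * D)) (f - g) &
    forall l i j, (l + i + j <= n)%N -> (low_exponent l i j < N)%N ->
      (wexp (f - g))`_(n * (2 * D))`_(low_exponent l i j) = 0].
Proof.
move=> Of; elim: N => [|N [g [Ig Ofg gP]]].
  by exists 0; split; [apply: ideal0; apply: is_ideal_power|rewrite subr0|].
have [[l [i [j [le eN]]]]|noN] := pselect (exists l i j, (l + i + j <= n)%N /\ low_exponent l i j = N);
  last first.
  exists g; split=> // l i j le; rewrite ltnS leq_eqVlt => /predU1P [eN|]; last exact: gP.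
  by case: noN; exists l, i, j.
have [a aE] := lift_coef (wexp (f - g))`_(n * (2 * D))`_N.
set c := (wexp (f - g))`_(n * (2 * D))`_N in aE.
pose b := late_monomial (n - l - i - j) l i j.
have nE : (n - l - i - j + l + i + j = n)%N by lia.
have [Ob bE] : O (n * (2 * D)) (a * b) /\ (wexp (a * b))`_(n * (2 * D)) = c%:P * product_part l i j.
  apply: lead_monomial; by rewrite wexpM aE wexp_monomial nE mulrA -polyCM.
exists (g + a * b); split.
- apply: idealD => //; first exact: is_ideal_power.
  by apply: idealMl; [apply: is_ideal_power|rewrite -nE; apply: late_monomial_power].
- by rewrite opprD addrA; exact: (idealB (is_ideal_weight k _) Ofg Ob).
have fgE : (wexp (f - (g + a * b)))`_(n * (2 * D)) =
    (wexp (f - g))`_(n * (2 * D)) - c%:P * product_part l i j.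
  by rewrite opprD addrA (wexpB (f - g)) coefB; congr (_ - _); exact: bE.
move=> l' i' j' le'; rewrite fgE coefB coefCM ltnS leq_eqVlt.
case/predU1P => [eN'|lt]; last by rewrite gP // product_part_low ?mulr0 ?subr0 // eN.
have gN : (product_part l i j)`_N = 1 by rewrite -eN product_part_lead.
by rewrite eN' gN mulr1 subrr.
Qed.

(** Clear the exponents of the products of generators from f. If s f is in I^n,
    the leading part of s times the remainder is in the leading space, and
    vanishes at all those exponents, so it is 0. *)
Lemma late_power_saturated n : (n < q)%N -> saturated (O 1) (ideal_power I n).
Proof.
move=> nq s f ns Isf.
have Of : O (n * (2 * D)) f.
  by apply: (weight_saturated ns); apply: (late_power_lead Isf).1.
have [g [Ig Ofg gP]] := late_reduction (n * D).+1 Of.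
apply: (idealBr (is_ideal_power I n) _ Ig); apply: weight_sub_late_power.
apply: weight_idealS => //.
have Isfg : ideal_power I n (s * (f - g)).
  rewrite mulrBr; apply: idealB => //; first exact: is_ideal_power.
  by apply: idealMl => //; apply: is_ideal_power.
have [_] := late_power_lead Isfg.
have [_] := weight_idealM (weight_ideal0 s) Ofg; rewrite add0n => ->.
move=> /(leading_space_eq0 nq) sf0; have /eqP : (wexp s)`_0 * (wexp (f - g))`_(n * (2 * D)) = 0.
  apply: sf0 => l i j le; rewrite [X in X * _]wexp_coef0 coefCM gP ?mulr0 //.
  by rewrite ltnS /low_exponent; have := D_gt; nia.
by rewrite mulf_eq0 (negPf (not_weight1 ns)) /= => /eqP.
Qed.

Lemma late_saturated : saturated (O 1) I.
Proof.
have := late_power_saturated (n := 1) q2.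
by rewrite ideal_power1 //; apply: is_ideal_late.
Qed.

Lemma late_not1 : ~ I 1.
Proof.
move=> /late_lead [O1 _]; have D0 : (0 < 2 * D)%N by rewrite DE; lia.
by have /eqP := O1 0%N D0; rewrite rmorph1 coef1 oner_eq0.
Qed.

Lemma late_ass : Ass I (O 1).
Proof.
split; first exact: weight_prime.
apply: (coprimary_colon (@mpoly_noetherian k 3) (weight_prime k) _ late_not1).
split; [exact: is_ideal_late|exact: late_saturated|].
move=> a Oa; exists (2 * D).+1; apply: weight_sub_late.
rewrite -[X in O X]muln1; apply: (weight_power (I := O 1)) => //.
exact: ideal_power_exp.
Qed.

Lemma late_symbolic_weight n f : symbolic_power I n f -> O (n * (2 * D)) f.
Proof.
move=> /symbolic_powerP /(_ _ late_ass) [s ns /late_power_lead [Osf _]].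
exact: weight_saturated Osf.
Qed.

(** The quotient of v^(q-1) w - u^q by t^kappa. *)
Definition late_special : A := 'X_x0 ^+ (2 + 2 * D * q.-1) * 'X_x1 ^+ (D.-1).

Lemma late_special_symbolic : symbolic_power I q late_special.
Proof.
apply/symbolic_powerP => P [prP [g PE]]; exists ('X_x2 ^+ kappa).
  move=> /(prime_exp prP); rewrite PE /= => /late_saturated Ig.
  apply: (prime_not1 prP); rewrite PE /= mul1r; apply: Ig.
  by move=> /(_ 0%N isT) /eqP; rewrite wexp_var2 coefC /= polyC_eq0 polyX_eq0.
rewrite (_ : _ * _ = late_v ^+ q.-1 * late_w - late_u ^+ q).
  apply: idealB; first exact: is_ideal_power.
    have qE : (q.-1 + 1 = q)%N by lia.
    rewrite -[X in ideal_power _ X]qE; apply: ideal_power_mul.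
      by apply: ideal_power_exp; apply: late_gen_v.
    by rewrite ideal_power1; [apply: late_gen_w|apply: is_ideal_late].
  by apply: ideal_power_exp; apply: late_gen_u.
rewrite /late_special /late_v /late_w /late_u exprMn -!exprM mulrDr.
rewrite (_ : (2 * D - 2) * q = 2 * D * q.-1 + (2 * D - 2 * q))%N; last by rewrite DE; nia.
by rewrite !(exprD 'X_x0); ring.
Qed.

Lemma late_special_power : ~ ideal_power I q late_special.
Proof.
move=> /late_power_lead [_]; rewrite /late_special wexp_xy.
rewrite (_ : 2 + 2 * D * q.-1 + 2 * D.-1 = q * (2 * D))%N; last by rewrite DE; nia.
by rewrite coefMXn ltnn subnn coefC /=; apply: leading_space_special.
Qed.

Lemma late_first_failure : first_failure I q.
Proof.
split; last by move=> /(_ _ late_special_symbolic) /late_special_power.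
move=> j jq f /symbolic_powerP /(_ _ late_ass) [s ns].
exact: late_power_saturated.
Qed.

Lemma late_resurgence (R : realType) : resurgence R I = 1%:E.
Proof.
apply/eqP; rewrite eq_le; apply/andP; split.
  apply/resurgence_le => m r m1 r1 nsub; rewrite mul1r ler_nat leqNgt; apply/negP => rm.
  apply: nsub => f /late_symbolic_weight Of; apply: weight_sub_late_power.
  by apply: weight_idealW Of; rewrite DE; nia.
have q0 : (0 < q)%N by apply: ltnW.
have := resurgence_ge R q0 q0 late_first_failure.2.
by rewrite divff // pnatr_eq0 -lt0n.
Qed.

Lemma late_homogeneous : nonzero_proper_homogeneous I.
Proof.
have X1 (i : 'I_3) : ('X_i : A) \is 1.-homog by rewrite dhomogX; apply/eqP; exact: mdeg1.
have Xn (i : 'I_3) d : ('X_i ^+ d : A) \is d.-homog.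
  by have := dhomogMn d (X1 i); rewrite mul1n.
split.
- exists late_gens => // f [[]->|[m _ ->]].
  + by exists (2 * D)%N; exact: Xn.
  + by exists ((2 * D - 2) + 1)%N; rewrite dhomogM ?Xn ?X1.
  + by exists D; exact: Xn.
  + exists ((2 * D - 2 * q) + q)%N; apply: rpredD; first exact: dhomogM.
    rewrite (_ : 2 * D - 2 * q + q = kappa + (2 + D.-1))%N.
      by apply: dhomogM => //; apply: dhomogM.
    by move: kappaE; rewrite DE; nia.
  + by exists (mdeg m); rewrite dhomogX.
- move=> I0; have := late_gen_v; rewrite I0 /= => /(congr1 (@wexp k)).
  by rewrite wexp_v rmorph0 => /eqP; rewrite -size_poly_eq0 size_polyXn.
- by move=> IT; apply: late_not1; rewrite IT.
Qed.

End Example.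

(** * An ideal whose symbolic and ordinary powers agree *)

(** The ideal (x^2, y), presented as the polynomials of weight at least 2: its
    powers are terms of the weight filtration, hence saturated. *)
Section Weight2.

Variables (k : fieldType) (R : realType).
Local Notation A := {mpoly k[3]}.
Local Notation x0 := (@Ordinal 3 0 isT).
Local Notation x1 := (@Ordinal 3 1 isT).
Local Notation O := (@weight_ideal k).

Lemma weight2_power n : ideal_power (O 2) n = O (n * 2)%N.
Proof.
apply/seteqP; split; first exact: weight_power.
case: n => [|n] f Of; first exact: ideal_power0.
have := @weight_sub_power k (O 2) 1 0 n.+1 (is_ideal_weight k 2) isT.
rewrite muln1 !addn0; apply=> //.
  by rewrite mpolyXn; apply: weight_idealX; rewrite /weight !mulmnE !mnm1E.
by rewrite mpolyXn; apply: weight_idealX; rewrite /weight !mulmnE !mnm1E.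
Qed.

Lemma weight2_not1 : ~ O 2 1.
Proof. by move=> /(_ 0%N isT) /eqP; rewrite rmorph1 coef1 oner_eq0. Qed.

Lemma weight2_ass : Ass (O 2) (O 1).
Proof.
split; first exact: weight_prime.
apply: (coprimary_colon (@mpoly_noetherian k 3) (weight_prime k) _ weight2_not1).
split; [exact: is_ideal_weight|exact: weight_saturated|].
move=> a Oa; exists 2%N.
have := @weight_power k (O 1) 1 2 (fun=> id); rewrite muln1; apply.
exact: ideal_power_exp.
Qed.

Lemma weight2_symbolic n : symbolic_power (O 2) n `<=` ideal_power (O 2) n.
Proof.
move=> f /symbolic_powerP /(_ _ weight2_ass) [s ns].
by rewrite weight2_power; apply: weight_saturated.
Qed.

Lemma weight2_resurgence : resurgence R (O 2) = 1%:E.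
Proof.
have ge n : ((n.+1%:R / n.+2%:R)%:E <= resurgence R (O 2))%E.
  apply: resurgence_ge => // sub.
  have /sub : symbolic_power (O 2) n.+1 ('X_x1 ^+ n.+1).
    apply: ideal_power_sub_symbolic; apply: ideal_power_exp.
    by apply: weight_idealX; rewrite /weight !mnm1E.
  rewrite weight2_power mpolyXn => Of.
  have := weight_ideal_supp Of (m := (U_(x1) *+ n.+1)%MM).
  by rewrite msuppX mem_head => /(_ isT); rewrite /weight !mulmnE !mnm1E /=; lia.
apply/eqP; rewrite eq_le; apply/andP; split.
  apply/resurgence_le => m r m1 r1 nsub; rewrite mul1r ler_nat leqNgt; apply/negP => rm.
  by apply: nsub => f /weight2_symbolic; apply: ideal_powerW; apply: ltnW.
rewrite leNgt; apply/negP => lt1.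
have := ge 0%N; have := ge; move: lt1; case: (resurgence R (O 2)) => [r|//|//] r1 {}ge _.
rewrite lte_fin -subr_gt0 in r1.
have [n nP] : exists n, (1 - r)^-1 < n%:R.
  by exists (Num.bound (1 - r)^-1); apply: archi_boundP; rewrite invr_ge0 ltW.
move: nP; rewrite -[X in X < _]mulr1 ltr_pdivrMl // => nP.
have := ge n; rewrite lee_fin ler_pdivrMr ?ltr0n // -!natr1 => geR.
by lra.
Qed.

Lemma weight2_homogeneous : nonzero_proper_homogeneous (O 2).
Proof.
split.
- exists [set f | exists2 m, (2 <= weight m)%N & f = 'X_[m]].
    by move=> _ [m _ ->]; exists (mdeg m); rewrite dhomogX.
  apply/seteqP; split.
    apply: weight_ideal_min; first exact: is_ideal_gen.
    by move=> m m2; apply: sub_ideal_gen; exists m.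
  apply: ideal_gen_min; first exact: is_ideal_weight.
  by move=> _ [m m2 ->]; apply: weight_idealX.
- move=> O0; have : O 2 'X_x1 by apply: weight_idealX; rewrite /weight !mnm1E.
  by rewrite O0 /= => /eqP; rewrite (negPf (mpolyX_neq0 _ _)).
- by move=> OT; apply: weight2_not1; rewrite OT.
Qed.

End Weight2.

(** * The possible resurgences of sums *)

Lemma homogeneous_proper (k : fieldType) n (I : set {mpoly k[n]}) :
  nonzero_proper_homogeneous I -> is_ideal I /\ ~ I 1.
Proof.
move=> [[S _ ->] _ nT]; split; first exact: is_ideal_gen.
by move=> I1; apply: nT; apply/seteqP; split=> // x _; apply: ideal_all (is_ideal_gen _) I1 x.
Qed.

Theorem proposition4p1 (R : realType) (k : fieldType) (a b : R)
    (ha : 1 <= a) (hb : 1 <= b) :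
  let M := Num.max a b in
  let m := Num.min a b in
  [/\ Res k a b `<=`
        [set q | (M%:E <= q)%E /\ (q <= (Num.max M (2 * (a + b) / 3))%:E)%E],
      2 * m <= M -> Res k a b !=set0 -> Res k a b = [set M%:E]
    & Res k (1 : R) 1 =
        [set 1%:E] `|`
        [set q | exists2 n : nat, (3 <= n)%N & q = (n.+1%:R / n%:R)%:E]].
Proof.
move=> M m.
have bounds : Res k a b `<=`
    [set q | (M%:E <= q)%E /\ (q <= (Num.max M (2 * (a + b) / 3))%:E)%E].
  move=> _ [n [p [I [J [hI hJ Ia Jb ->]]]]].
  have [idI nI1] := homogeneous_proper hI; have [idJ nJ1] := homogeneous_proper hJ.
  have [geI geJ] := resurgence_sum_ge R idI idJ nI1 nJ1.
  split; first by rewrite /M; case: (leP a b) => _; rewrite -?Jb -?Ia.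
  apply: (resurgence_sum_le idI idJ Ia Jb); rewrite ?le_max /M ?le_max ?lexx ?orbT //.
  have : 2 * (a + b) / 3 <= Num.max (Num.max a b) (2 * (a + b) / 3).
    by rewrite le_max lexx orbT.
  by lra.
split=> //.
- move=> mM [q0 q0Res].
  have ME : Num.max M (2 * (a + b) / 3) = M.
    apply/max_idPl; move: mM; rewrite /m /M; case: (leP a b) => _; lra.
  have eqM q : Res k a b q -> q = M%:E.
    by move=> /bounds [ge]; rewrite ME => le; apply/eqP; rewrite eq_le le ge.
  apply/seteqP; split=> [q /eqM //|_ ->]; by rewrite -(eqM q0).
apply/seteqP; split.
  move=> _ [n [p [I [J [hI hJ I1 J1 ->]]]]].
  have [idI nI1] := homogeneous_proper hI; have [idJ nJ1] := homogeneous_proper hJ.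
  have [noI|[i0 Fi]] := first_failure_dichotomy I.
    by left; apply: resurgence_sum_no_failure => //; left.
  have [noJ|[j0 Fj]] := first_failure_dichotomy J.
    by left; apply: resurgence_sum_no_failure => //; right.
  right; exists (i0 + j0).-1; last rewrite (resurgence_sum_first_failure idI idJ I1 J1 Fi Fj).
    have := first_failure_ge2 (@mpoly_noetherian k n) idI Fi.
    by have := first_failure_ge2 (@mpoly_noetherian k p) idJ Fj; lia.
  rewrite prednK //.
  by have := first_failure_ge2 (@mpoly_noetherian k n) idI Fi; lia.
move=> _ [->|[n n3 ->]].
  have hO := weight2_homogeneous k; have [idO nO1] := homogeneous_proper hO.
  exists 3%N, 3%N, (@weight_ideal k 2), (@weight_ideal k 2).
  rewrite !weight2_resurgence; split=> //.
  rewrite resurgence_sum_no_failure ?weight2_resurgence //.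
  by left=> i; apply: weight2_symbolic.
(* n + 1 = 2 + (n - 1), with first failures at 2 and at n - 1 *)
pose ex q := @late_ideal k q (q * q + 2) (q * q + 1 - q).
have exP q : (2 <= q)%N ->
    [/\ nonzero_proper_homogeneous (ex q), resurgence R (ex q) = 1%:E & first_failure (ex q) q].
  move=> q2; have kE : ((q * q + 1 - q) + q = q * q + 1)%N by nia.
  split; [exact: late_homogeneous|exact: late_resurgence|exact: late_first_failure].
have n2 : (2 <= n.-1)%N by lia.
have [h2 r2 f2] := exP 2%N isT; have [hn rn fn] := exP _ n2.
have [id2 n21] := homogeneous_proper h2; have [idn nn1] := homogeneous_proper hn.
exists 3%N, 3%N, (ex 2%N), (ex n.-1); split=> //.
rewrite (resurgence_sum_first_failure id2 idn r2 rn f2 fn).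
by rewrite (_ : 2 + n.-1 = n.+1)%N //; lia.
Qed.
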